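(* Let $d\ge 2$ and $s>d/2$. Let $(X_m)$ be a sequence of QMC designs for $H^s(\mathbb{S}^d)$, where $X_m=\{x_1,\dots,x_m\}$ is an $m$-point configuration. There exist constants $c'(s,d)>0$ and $c''(s,d)>0$, independent of $f$, $n$ and $m$, such that for every $f\in H^s(\mathbb{S}^d)$, every integer $n\ge 1$ and every $m$ in the index set of the sequence, the QMC hyperinterpolant $\mathcal{Q}_nf$ of degree $n$ built from $X_m$ satisfies $$\|\mathcal{Q}_nf\|_{L^2}\le\|f\|_{L^2}+\frac{c'(s,d)}{m^{s/d}}(n+1)^s\|f\|_{H^s}$$ and $$\|\mathcal{Q}_nf-f\|_{L^2}\le c''(s,d)\left(n^{-s}+\frac{1}{m^{s/d}}\sqrt{\frac{Z(d+1,n)}{a_n^{(s)}}}\right)\|f\|_{H^s}.$$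
   Context: $\mathbb{S}^d$ is the unit sphere in $\mathbb{R}^{d+1}$, $\omega_d$ its (unnormalized) surface measure, $|\mathbb{S}^d|=\int_{\mathbb{S}^d}\mathrm{d}\omega_d$; $\|\cdot\|_{L^2}$ and $\langle\cdot,\cdot\rangle$ refer to real $L^2(\mathbb{S}^d,\omega_d)$. For each $\ell\ge0$, $\{Y_{\ell,k}:k=1,\dots,Z(d,\ell)\}$ is an $L^2$-orthonormal basis of the real spherical harmonics of exact degree $\ell$; $Z(d,0)=1$, $Z(d,\ell)=(2\ell+d-1)\frac{\Gamma(\ell+d-1)}{\Gamma(d)\Gamma(\ell+1)}$ for $\ell\ge 1$, and $Z(d+1,n)$ is the dimension of the space $\mathbb{P}_n(\mathbb{S}^d)$ of spherical polynomials of degree at most $n$. Put $\hat f_{\ell,k}=\langle f,Y_{\ell,k}\rangle$. Sobolev space: for $s>d/2$ fix a sequence of positive reals $(a_\ell^{(s)})_{\ell\ge0}$ with $a_\ell^{(s)}\asymp(1+\ell)^{-2s}$ (bounded above and below by positive constant multiples, uniformly in $\ell$). $H^s(\mathbb{S}^d)$ is the set of $f\in L^2(\mathbb{S}^d)$ with $\|f\|_{H^s}:=\big(\sum_{\ell\ge0}\sum_{k=1}^{Z(d,\ell)}\frac{1}{a_\ell^{(s)}}|\hat f_{\ell,k}|^2\big)^{1/2}<\infty$; since $s>d/2$ its elements are identified with their continuous representatives. A sequence of $m$-point configurations $X_m=\{x_1,\dots,x_m\}\subset\mathbb{S}^d$, with $m\to\infty$ along an infinite set of positive integers, is a sequence of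 QMC designs for $H^s(\mathbb{S}^d)$ if there is $c(s,d)>0$ independent of $m$ with $\left|\frac{|\mathbb{S}^d|}{m}\sum_{j=1}^mf(x_j)-\int_{\mathbb{S}^d}f\,\mathrm{d}\omega_d\right|\le\frac{c(s,d)}{m^{s/d}}\|f\|_{H^s}$ for all $f\in H^s(\mathbb{S}^d)$ and all such $m$. The QMC hyperinterpolant of degree $n$ built from $X_m$ is $\mathcal{Q}_nf=\sum_{\ell=0}^n\sum_{k=1}^{Z(d,\ell)}\langle f,Y_{\ell,k}\rangle_mY_{\ell,k}$ with $\langle f,g\rangle_m=\frac{|\mathbb{S}^d|}{m}\sum_{j=1}^mf(x_j)g(x_j)$. The constants $c'(s,d),c''(s,d)$ may depend on $s$, $d$, the fixed sequence $(a_\ell^{(s)})$ and the QMC constant $c(s,d)$ of the sequence. *)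

(* Defs.v *)
From HB Require Import structures.
From mathcomp Require Import all_boot all_order all_algebra.
From mathcomp Require Import all_classical all_reals all_analysis.
From mathcomp Require Import measurable_realfun.
From mathcomp Require mpoly.
Import Order.TTheory GRing.Theory Num.Theory.
Import numFieldNormedType.Exports.

Set Implicit Arguments.
Unset Strict Implicit.
Unset Printing Implicit Defensive.

Local Open Scope classical_set_scope.
Local Open Scope ring_scope.

(* The sigma-algebra generated by the coordinates; on 'rV[R]_n it is the Borel
   sigma-algebra. *)
Section measurable_rV.
Context {d : measure_display} {T : measurableType d} (n : nat).

Let coord (i : 'I_n) (x : 'rV[T]_n) : T := x ord0 i.

Let rV_set0 : g_sigma_preimage coord set0.
Proof. exact: sigma_algebra0. Qed.

Let rV_setC A : g_sigma_preimage coord A -> g_sigma_preimage coord (~` A).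
Proof. exact: sigma_algebraC. Qed.

Let rV_bigcup (F : (set 'rV[T]_n)^nat) :
  (forall i, g_sigma_preimage coord (F i)) ->
  g_sigma_preimage coord (\bigcup_i (F i)).
Proof. exact: sigma_algebra_bigcup. Qed.

HB.instance Definition _ := @isMeasurable.Build (measure_tuple_display d)
  'rV[T]_n (g_sigma_preimage coord) rV_set0 rV_setC rV_bigcup.

End measurable_rV.

Section lebesgue_tuple.
Variable R : realType.
Local Notation mR := (measurableTypeR R).

Definition tuple_cons n (p : n.-tuple mR * mR) : n.+1.-tuple mR :=
  [tuple of p.2 :: p.1].

Lemma measurable_tuple_cons n : measurable_fun setT (@tuple_cons n).
Proof. exact: measurable_cons. Qed.

HB.instance Definition _ n := isMeasurableFun.Build _ _ _ _ (@tuple_cons n)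
  (@measurable_tuple_cons n).

Section step.
Context n (mu : {measure set (n.-tuple mR) -> \bar R}).

Definition lebesgue_cons : set (n.+1.-tuple mR) -> \bar R :=
  pushforward (mu \x (@lebesgue_measure R))%E (@tuple_cons n).

Let lebesgue_cons0 : lebesgue_cons set0 = 0%E.
Proof. exact: measure0. Qed.

Let lebesgue_cons_ge0 A : (0 <= lebesgue_cons A)%E.
Proof. exact: measure_ge0. Qed.

Let lebesgue_cons_sigma_additive : semi_sigma_additive lebesgue_cons.
Proof. exact: measure_semi_sigma_additive. Qed.

HB.instance Definition _ := isMeasure.Build _ _ _ lebesgue_cons
  lebesgue_cons0 lebesgue_cons_ge0 lebesgue_cons_sigma_additive.

End step.

Fixpoint lebesgue_tuple n : {measure set (n.-tuple mR) -> \bar R} :=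
  if n is m.+1 then lebesgue_cons (lebesgue_tuple m)
  else \d_([tuple] : 0.-tuple mR).

End lebesgue_tuple.

Section sphere.
Variable R : realType.
Local Notation mR := (measurableTypeR R).

Definition sphere d : set 'rV[R]_d.+1 :=
  [set x | \sum_(i < d.+1) x ord0 i ^+ 2 = 1].

Definition unit_ball_tuple n : set (n.-tuple mR) :=
  [set t | \sum_(i < n) tnth t i ^+ 2 <= 1].

(* x / |x| for the Euclidean norm, with value 0 at 0. *)
Definition radial_proj n (t : n.-tuple mR) : 'rV[R]_n :=
  \row_(i < n) (tnth t i / Num.sqrt (\sum_(j < n) tnth t j ^+ 2)).

Lemma measurable_sqr_norm_tuple n :
  measurable_fun setT (fun t : n.-tuple mR => \sum_(i < n) tnth t i ^+ 2 : R).
Proof.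
apply: measurable_sum => i; apply: measurable_funX.
exact: measurable_tnth.
Qed.

Lemma measurable_unit_ball_tuple n : measurable (@unit_ball_tuple n).
Proof.
have := @measurable_sqr_norm_tuple n measurableT _ (measurable_itv `]-oo, 1]).
by rewrite setTI; congr measurable.
Qed.

Lemma measurable_fun_rV d (T : measurableType d) n (f : T -> 'rV[R]_n) :
  (forall i, measurable_fun setT (fun x => f x ord0 i)) ->
  measurable_fun setT f.
Proof.
move=> mf _ A mA; rewrite setTI.
suff : g_sigma_preimage (fun i x => f x ord0 i) `<=` measurable.
  apply; rewrite (g_sigma_preimage_comp (fun i (x : 'rV[R]_n) => x ord0 i)).
  by exists A => //; rewrite setTI.
apply: smallest_sub; first exact: sigma_algebra_measurable.
case: n => [|n] in f mf A mA *; first by rewrite big_ord0.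
rewrite -bigcup_mkord_ord; apply: bigcup_sub => i _.
by move=> _ [B mB <-]; exact: mf.
Qed.

Lemma measurable_radial_proj n : measurable_fun setT (@radial_proj n).
Proof.
apply: measurable_fun_rV => i.
under eq_fun => t.
  rewrite mxE -powR12_sqrt; last by apply: sumr_ge0 => j _; exact: sqr_ge0.
  rewrite -powRN; over.
apply: measurable_funM; first exact: measurable_tnth.
apply: (measurableT_comp (measurable_powR (- 2^-1))).
exact: measurable_sqr_norm_tuple.
Qed.

HB.instance Definition _ n := isMeasurableFun.Build _ _ _ _ (@radial_proj n)
  (@measurable_radial_proj n).

Definition cone_measure d : set 'rV[R]_d.+1 -> \bar R :=
  pushforward (mrestr (lebesgue_tuple R d.+1) (@measurable_unit_ball_tuple d.+1))
    (@radial_proj d.+1).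

Section cone_measure.
Variable d : nat.

Let cone_measure0 : @cone_measure d set0 = 0%E.
Proof. exact: measure0. Qed.

Let cone_measure_ge0 A : (0 <= @cone_measure d A)%E.
Proof. exact: measure_ge0. Qed.

Let cone_measure_sigma_additive : semi_sigma_additive (@cone_measure d).
Proof. exact: measure_semi_sigma_additive. Qed.

HB.instance Definition _ := isMeasure.Build _ _ _ (@cone_measure d)
  cone_measure0 cone_measure_ge0 cone_measure_sigma_additive.

End cone_measure.

(* For A contained in the sphere of R^(d+1), the surface measure of A is (d+1)
   times the Lebesgue measure of the cone {r x | x in A, 0 < r <= 1}: integrate
   r^d over 0 < r <= 1 in polar coordinates. *)
Definition surface_measure d : {measure set 'rV[R]_d.+1 -> \bar R} :=
  mscale (d.+1%:R)%:nng (@cone_measure d).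

End sphere.
Arguments sphere {R} d.
Arguments surface_measure {R} d.

(* Functions on the sphere are represented by functions on 'rV[R]_d.+1; every
   notion below only depends on their values on the sphere. *)
Section sobolev.
Context {R : realType} {d : nat}.
Implicit Types f g : 'rV[R]_d.+1 -> R.

Definition sphere_integral f : R :=
  \int[surface_measure d]_(x in sphere d) f x.

Definition L2 f : Prop :=
  measurable_fun (sphere d) f /\
  (surface_measure d).-integrable (sphere d) (fun x => (f x ^+ 2)%:E).

Definition L2dot f g : R := sphere_integral (fun x => f x * g x).

Definition L2norm f : R := Num.sqrt (L2dot f f).

End sobolev.

Section spherical_harmonic.
(* Local, as mpoly shadows names and notations of MathComp-Analysis. *)
Import -(notations) mpoly.
Context {R : realType} {d : nat}.

Definition spherical_harmonic (l : nat) (f : 'rV[R]_d.+1 -> R) : Prop :=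
  exists p : mpoly d.+1 R,
    [/\ p \is ishomog1 l mdeg,
        \sum_(i < d.+1) mderiv i (mderiv i p) = 0 &
        forall x, sphere d x -> f x = meval (x ord0) p].

End spherical_harmonic.

(* Z(d, l); for d >= 2 and l >= 1 the Gamma values are Gamma(l + d - 1) =
   (l + d - 2)!, Gamma(d) = (d - 1)! and Gamma(l + 1) = l!, and the division is
   exact (dim_harmonicE). *)
Definition dim_harmonic (d l : nat) : nat :=
  if l == 0%N then 1%N
  else (((2 * l + d - 1) * (l + d - 2)`!) %/ ((d - 1)`! * l`!))%N.

Lemma dim_harmonicE d l : (2 <= d)%N -> (1 <= l)%N ->
  (dim_harmonic d l * ((d - 1)`! * l`!) = (2 * l + d - 1) * (l + d - 2)`!)%N.
Proof.
case: d => [|[|d]] // _; case: l => [|l] // _.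
rewrite /dim_harmonic /=.
have -> : (d.+2 - 1 = d.+1)%N by rewrite subn1.
have -> : (l.+1 + d.+2 - 2 = l.+1 + d)%N by rewrite !addnS !subSS subn0.
have -> : (2 * l.+1 + d.+2 - 1 = (l.+1 + d.+1) + l.+1)%N.
  by rewrite mulSn mul1n !addnS subn1 /= !addSn addnAC.
apply: divnK.
rewrite mulnDl; apply: dvdn_add.
  have -> : ((l.+1 + d.+1) * (l.+1 + d)`! = (l.+1 + d.+1)`!)%N.
    by rewrite addnS factS.
  apply/dvdnP; exists ('C(l.+1 + d.+1, d.+1))%N.
  by rewrite -{1}(bin_fact (leq_addl l.+1 d.+1)) addnK.
apply/dvdnP; exists ('C(l + d.+1, d.+1))%N.
rewrite addSnnS -(bin_fact (leq_addl l d.+1)) addnK (factS l).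
by rewrite mulnCA; congr muln; rewrite mulnCA.
Qed.

Section hyperinterpolation.
Context {R : realType} {d : nat}.
Implicit Types f g : 'rV[R]_d.+1 -> R.

Definition harmonic_basis
    (Y : forall l : nat, 'I_(dim_harmonic d l) -> 'rV[R]_d.+1 -> R) : Prop :=
  forall l : nat,
    [/\ forall k, spherical_harmonic l (Y l k),
        forall k k', L2dot (Y l k) (Y l k') = (k == k')%:R &
        forall g, spherical_harmonic l g -> exists b : 'I_(dim_harmonic d l) -> R,
          forall x, sphere d x -> g x = \sum_k b k * Y l k x].

Definition sobolev_weights (s : R) (a : nat -> R) : Prop :=
  (forall l, 0 < a l) /\
  exists c C : R, [/\ 0 < c, 0 < C & forall l : nat,
    c * (1 + l%:R) `^ (- (2 * s)) <= a l <= C * (1 + l%:R) `^ (- (2 * s))].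

Variable a : nat -> R.
Variable Y : forall l : nat, 'I_(dim_harmonic d l) -> 'rV[R]_d.+1 -> R.

Definition sobolev_sqnorm f : \bar R :=
  (\sum_(0 <= l <oo)
    (\sum_(k < dim_harmonic d l) (a l)^-1 * `|L2dot f (Y k)| ^+ 2)%:E)%E.

Definition sobolev_norm f : R := Num.sqrt (fine (sobolev_sqnorm f)).

(* H^s consists of continuous representatives; s enters through a. *)
Definition sobolev f : Prop :=
  [/\ {within sphere d, continuous f}, L2 f & (sobolev_sqnorm f < +oo)%E].

Definition discrete_dot m (x : 'I_m -> 'rV[R]_d.+1) f g : R :=
  sphere_integral (d := d) (fun=> 1) / m%:R * \sum_(j < m) f (x j) * g (x j).

(* I is the index set of the sequence; repeated points are allowed. *)
Definition QMC_designs (s c : R) (I : set nat)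
    (X : forall m : nat, 'I_m -> 'rV[R]_d.+1) : Prop :=
  [/\ infinite_set I,
      forall m, I m -> (0 < m)%N /\ forall j : 'I_m, sphere d (X m j) &
      forall m f, I m -> sobolev f ->
        `| sphere_integral (d := d) (fun=> 1) / m%:R * \sum_(j < m) f (X m j)
           - sphere_integral f |
        <= c / m%:R `^ (s / d%:R) * sobolev_norm f].

Definition hyperinterpolant (n m : nat) (x : 'I_m -> 'rV[R]_d.+1) f :
    'rV[R]_d.+1 -> R :=
  fun y => \sum_(l < n.+1) \sum_(k < dim_harmonic d l)
    discrete_dot x f (Y k) * Y k y.

End hyperinterpolation.

(* Main.v *)
(** Since [||Q_n f||^2 = <f, Q_n f>_m], both estimates follow from the
  quadrature
    error for the product [f p], with [p = Q_n f], respectively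
    [p = Q_n f - P_n f] where [P_n] is the orthogonal projection, once one knows
    that [||f p||_(H^s) <= C (n + 1)^s ||f||_(H^s) ||p||_(L^2)] for [p] of
      degree
    at most [n].  The coefficients of [f p] of degree [l < 2 n] are controlled
      by
    Bessel's inequality and [||f||_oo <= C ||f||_(H^s)].  Those of degree in
    [[q n, (q + 1) n)], [q >= 2], only involve the coefficients of [f] of degree
    in [[(q - 1) n, (q + 2) n)], on which the weights are comparable, and one
    uses [||p||_oo^2 <= C (n + 1)^d ||p||^2] with [d < 2 s].

    On the sphere everything comes from the invariance of the surface measure
    under plane rotations, each a product of three shears.  Infinitesimally, it
    says that the fields [x_i d_j - x_j d_i] have mean zero, which gives the
    orthogonality of harmonics of different degrees; globally, it makes
    [sum_k Y_(l,k)^2] constant.  The partial sums of [f] in [H^s] converge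
    uniformly since [s > d / 2]; their limit is [f], because a discrepancy at
    [x0] would be detected by the polynomial [((1 + <x, x0>) / 2)^D], [D]
    large. *)

Require Import Defs.
From HB Require Import structures.
From mathcomp Require Import all_boot all_order all_algebra.
From mathcomp Require Import all_classical all_reals all_analysis.
From mathcomp Require Import measurable_realfun.
From mathcomp Require Import ring lra zify.
From mathcomp Require mpoly.
Import Order.TTheory GRing.Theory Num.Theory.
Import numFieldNormedType.Exports.

Local Open Scope classical_set_scope.
Local Open Scope ring_scope.

Set Implicit Arguments.
Unset Strict Implicit.
Unset Printing Implicit Defensive.

(** * Invariance of the surface measure *)

Section lebesgue_tuple_theory.
Context {R : realType}.
Local Notation mR := (measurableTypeR R).

(** The quadrature bound is a hypothesis on members of H^s only, and [c'], [c''] are chosen before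
    the basis, the points and f. So f p must be shown to lie in H^s, with a constant made of [s],
    [d], the area of the sphere and the bounds [c0], [C0] of the weights. Completeness of the
    harmonics is not taken for granted: Bessel's inequality alone bounds neither sup |f| nor the L^2
    distance from f to its partial sums, and identifying f with the limit of its series supplies
    both.

    All integrands are bounded and measurable on the sphere. Basis functions and members of H^s are
    arbitrary off it, so polynomial representatives are substituted where continuity, or
    measurability on the whole space, is required.

    The factor sqrt(Z(d + 1, n) / a_n) comes in at the very end: as Z(d + 1, n) >= 1 and a_n <= C0
    (n + 1)^(-2 s), it dominates (n + 1)^s / sqrt(C0). *)

Lemma lebesgue_measure_translate (a : R) (A : set mR) : measurable A ->
  lebesgue_measure ((fun x : mR => x + a : mR) @^-1` A) = lebesgue_measure A.
Proof.
move=> mA.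
have mt : measurable_fun setT (fun x : mR => x + a : mR).
  exact: measurable_funD.
pose tr : {mfun mR >-> mR} := HB.pack (fun x : mR => x + a : mR)
  (isMeasurableFun.Build _ _ _ _ _ mt).
have -> : lebesgue_measure ((fun x : mR => x + a : mR) @^-1` A)
    = pushforward (@lebesgue_measure R) tr A by [].
apply/esym/lebesgue_measure_unique => // _ [[b c] _ <-] /=.
rewrite /pushforward.
have -> : tr @^-1` `]b, c]%classic = `](b - a), (c - a)]%classic.
  by apply/seteqP; split => x /=; rewrite !in_itv/= ltrBlDr lerBrDr.
rewrite !lebesgue_measure_itv /= !lte_fin.
by rewrite ltrD2r; case: ifP => // _; rewrite -!EFinD; congr (_%:E); ring.
Qed.

Lemma preimage_tuple_cons_box n (B : 'I_n.+1 -> set mR) :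
  @tuple_cons R n @^-1` [set t | forall i, B i (tnth t i)] =
  [set t | forall i, B (lift ord0 i) (tnth t i)] `*` B ord0.
Proof.
apply/seteqP; split => -[t x] /=.
  move=> h; split => [i|].
    by move: (h (lift ord0 i)); rewrite tnthS.
  exact: (h ord0).
move=> [h0 h1] i; case: (unliftP ord0 i) => [j ->|->//].
by rewrite tnthS; exact: h0.
Qed.

Lemma measurable_tuple_box n (B : 'I_n -> set mR) :
  (forall i, measurable (B i)) ->
  measurable [set t : n.-tuple mR | forall i, B i (tnth t i)].
Proof.
move=> mB; rewrite (_ : mkset _ = \bigcap_(i in [set: 'I_n])
    ((fun t : n.-tuple mR => tnth t i) @^-1` B i)).
  apply: fin_bigcap_measurable => // i _.
  by rewrite -[X in measurable X]setTI; exact: measurable_tnth.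
by apply/seteqP; split => t /= h i; [move=> _|]; exact: h.
Qed.

Lemma lebesgue_tuple_box n (B : 'I_n -> set mR) :
  (forall i, measurable (B i)) ->
  lebesgue_tuple R n [set t | forall i, B i (tnth t i)] =
  (\prod_(i < n) lebesgue_measure (B i))%E.
Proof.
elim: n B => [|n IHn] B mB /=.
  rewrite big_ord0 diracE mem_set//.
  by case.
rewrite /lebesgue_cons /pushforward preimage_tuple_cons_box.
rewrite product_measure1E//; last first.
  exact: (measurable_tuple_box (fun i => mB (lift ord0 i))).
by rewrite (IHn (fun i => B (lift ord0 i)))// big_ord_recl muleC.
Qed.


(** Required to exchange the order of integration in [lebesgue_tuple_shear]. *)
Lemma lebesgue_tuple_sigma_finite n : sigma_finite setT (lebesgue_tuple R n).
Proof.
exists (fun k : nat =>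
  [set t : n.-tuple mR | forall i, `[- k%:R : R, k%:R]%classic (tnth t i)]).
  apply/esym/seteqP; split => // t _.
  pose M := \sum_(i < n) `|tnth t i|.
  have [k Mk] : exists k : nat, M <= k%:R.
    by exists (Num.truncn M).+1; rewrite ltW// truncnS_gt.
  exists k => // i /=; rewrite in_itv/= -ler_norml; apply: le_trans Mk.
  rewrite /M (bigD1 i)//= lerDl; apply: sumr_ge0 => j _; exact: normr_ge0.
move=> k; split.
  by apply: (@measurable_tuple_box _ (fun=> `[- k%:R : R, k%:R]%classic)).
rewrite (@lebesgue_tuple_box _ (fun=> `[- k%:R : R, k%:R]%classic))//.
rewrite ltey_eq prode_fin_num// => i _; rewrite lebesgue_measure_itv/=.
by case: ifP.
Qed.

(* The eta-expansion is a key for canonical instances, unlike the measure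
   [lebesgue_tuple R n] computed by a fixpoint. *)
Definition lebesgue_tuple_sf n (A : set (n.-tuple mR)) : \bar R :=
  lebesgue_tuple R n A.

HB.instance Definition _ n := isMeasure.Build _ _ _ (@lebesgue_tuple_sf n)
  (measure0 (lebesgue_tuple R n)) (measure_ge0 (lebesgue_tuple R n))
  (@measure_semi_sigma_additive _ _ _ (lebesgue_tuple R n)).

HB.instance Definition _ n := Measure_isSigmaFinite.Build _ _ _
  (@lebesgue_tuple_sf n) (lebesgue_tuple_sigma_finite n).

Definition shear n (i : 'I_n) (h : n.-tuple mR -> mR) (t : n.-tuple mR) :
    n.-tuple mR :=
  [tuple (if j == i then tnth t j + h t else tnth t j) | j < n].

Lemma measurable_shear n (i : 'I_n) (h : n.-tuple mR -> mR) :
  measurable_fun setT h -> measurable_fun setT (shear i h).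
Proof.
move=> mh; apply/measurable_fun_tnthP => j.
rewrite (_ : _ \o _ =
  fun t => if j == i then tnth t j + h t else tnth t j); last first.
  by apply/funext => t /=; rewrite tnth_mktuple.
case: (j == i); last exact: measurable_tnth.
by apply: measurable_funD => //; exact: measurable_tnth.
Qed.

Let tnth_tuple_consS n (p : n.-tuple mR * mR) j :
  tnth (tuple_cons p) (lift ord0 j) = tnth p.1 j.
Proof. by rewrite !(tnth_nth p.2). Qed.

Let shear_cons0 n (h : n.+1.-tuple mR -> mR) t x :
  shear ord0 h (tuple_cons (t, x)) = tuple_cons (t, x + h (tuple_cons (t, x))).
Proof.
apply: eq_from_tnth => k; rewrite tnth_mktuple.
by case: (unliftP ord0 k) => [j ->|->] //; rewrite !tnth_tuple_consS.
Qed.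

Let shear_consS n (j : 'I_n) (h : n.+1.-tuple mR -> mR) t x :
  shear (lift ord0 j) h (tuple_cons (t, x)) =
  tuple_cons (shear j (fun t' => h (tuple_cons (t', x))) t, x).
Proof.
apply: eq_from_tnth => k; rewrite tnth_mktuple.
case: (unliftP ord0 k) => [l ->|->] //; rewrite !tnth_tuple_consS tnth_mktuple.
by rewrite (inj_eq lift_inj).
Qed.

(** Fubini: with the other coordinates fixed, [h] is constant, so the shear translates every section
    along coordinate [i]. The induction peels off the head of the tuple. *)
Lemma lebesgue_tuple_shear n (i : 'I_n) (h : n.-tuple mR -> mR) :
  measurable_fun setT h ->
  (forall t t', (forall j, j != i -> tnth t j = tnth t' j) -> h t = h t') ->
  forall A, measurable A ->
  lebesgue_tuple R n (shear i h @^-1` A) = lebesgue_tuple R n A.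
Proof.
elim: n i h => [[]//|n IHn] i h mh hi A mA.
have mA' : measurable (@tuple_cons R n @^-1` A).
  by rewrite -[X in measurable X]setTI; exact: measurable_tuple_cons.
have mT : measurable (@tuple_cons R n @^-1` (shear i h @^-1` A)).
  rewrite -[X in measurable X]setTI; apply: measurable_tuple_cons => //.
  by rewrite -[X in measurable X]setTI; exact: measurable_shear.
rewrite /= /lebesgue_cons /pushforward.
have [i0|[j ij]] : i = ord0 \/ exists j, i = lift ord0 j.
  by case: (unliftP ord0 i) => [j ->|->]; [right; exists j|left].
(* The sheared coordinate is the head, which this form of the product measure integrates
   innermost. *)
- rewrite /product_measure1; apply: eq_integral => t _ /=.
  rewrite -[RHS](@lebesgue_measure_translate (h (tuple_cons (t, 0))));
    last first.
    exact: measurable_xsection.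
  congr (lebesgue_measure _); apply/seteqP.
  have hE x : h (tuple_cons (t, x)) = h (tuple_cons (t, 0)).
    apply: hi => k; rewrite i0; case: (unliftP ord0 k) => [l ->|->] //.
    by rewrite !tnth_tuple_consS.
  by split => x /=; rewrite /xsection/= !inE/= i0 shear_cons0 (hE x).
(* Here the head has to be held fixed, so the other order of integration is needed; uniqueness of
   the product measure provides it. *)
- have sw B : measurable B -> ((lebesgue_tuple R n) \x (@lebesgue_measure R))%E
    B
      = ((lebesgue_tuple R n) \x^ (@lebesgue_measure R))%E B.
    move=> mB.
    have := @product_measure_unique _ _ _ _ R (@lebesgue_tuple_sf n)
      (@lebesgue_measure R)
      ((@lebesgue_tuple_sf n) \x^ (@lebesgue_measure R))%E.
    by apply => // C D mC mD; rewrite /= product_measure2E.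
  rewrite !sw// /product_measure2; apply: eq_integral => x _ /=.
  pose g t := h (tuple_cons (t, x)).
  have mg : measurable_fun setT g.
    apply: (measurableT_comp mh).
    apply: (measurableT_comp (@measurable_tuple_cons R n)).
    exact: measurable_fun_pair.
  rewrite -[RHS](IHn j g mg); last 2 first.
  - move=> t t' tt'; apply: hi => k; rewrite ij.
    case: (unliftP ord0 k) => [l ->|->] // lj; rewrite !tnth_tuple_consS;
      apply: tt'.
    by rewrite -(inj_eq (@lift_inj _ ord0)).
  - exact: measurable_ysection.
  congr (lebesgue_tuple R n _); apply/seteqP.
  by split => t /=; rewrite /ysection/= !inE/= ij shear_consS.
Qed.

End lebesgue_tuple_theory.

(** * Plane rotations and the surface measure *)

Section sphere_rotation.
Context {R : realType}.
Local Notation mR := (measurableTypeR R).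

(** Written for coordinate functions so as to serve both rows, where the sphere lives, and tuples,
    where the Lebesgue measure lives. The angle is given by its cosine [c] and sine [s]. *)
Definition rot_coord n (i j : 'I_n) (c s : R) (x : 'I_n -> R) (k : 'I_n) : R :=
  if k == i then c * x i - s * x j
  else if k == j then s * x i + c * x j else x k.

Definition plane_rot n (i j : 'I_n) (c s : R) (x : 'rV[R]_n) : 'rV[R]_n :=
  \row_k rot_coord i j c s (x ord0) k.

Lemma plane_rotE n (i j : 'I_n) c s (x : 'rV[R]_n) k :
  plane_rot i j c s x ord0 k = rot_coord i j c s (x ord0) k.
Proof. by rewrite mxE. Qed.

Lemma sqr_rot_coord n (i j : 'I_n) c s (x : 'I_n -> R) : i != j ->
  c ^+ 2 + s ^+ 2 = 1 ->
  \sum_k rot_coord i j c s x k ^+ 2 = \sum_k x k ^+ 2.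
Proof.
move=> ij cs.
rewrite (bigD1 i)//= (bigD1 j)//=; last by rewrite eq_sym.
rewrite [RHS](bigD1 i)//= [in RHS](bigD1 j)//=; last by rewrite eq_sym.
rewrite /rot_coord eqxx (negbTE (_ : j != i)) 1?eq_sym// eqxx !addrA.
congr (_ + _); first by rewrite -[RHS]mul1r -cs; ring.
by apply: eq_bigr => k /andP[/negbTE-> /negbTE->].
Qed.

Lemma rot_coordK n (i j : 'I_n) c s (x : 'I_n -> R) : i != j ->
  c ^+ 2 + s ^+ 2 = 1 ->
  rot_coord i j c (- s) (rot_coord i j c s x) =1 x.
Proof.
move=> ij cs k; rewrite /rot_coord eqxx.
rewrite [j == i]eq_sym (negbTE ij) eqxx.
case: eqP => [->|_]; first by rewrite -[RHS]mul1r -cs; ring.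
by case: eqP => [->|_//]; rewrite -[RHS]mul1r -cs; ring.
Qed.

Lemma plane_rotK n (i j : 'I_n) c s : i != j -> c ^+ 2 + s ^+ 2 = 1 ->
  cancel (plane_rot i j c s) (plane_rot i j c (- s)).
Proof.
move=> ij cs x; apply/rowP => k; rewrite plane_rotE.
have -> : plane_rot i j c s x ord0 = rot_coord i j c s (x ord0).
  by apply/funext => l; rewrite plane_rotE.
by rewrite rot_coordK.
Qed.

Lemma sphere_rot d (i j : 'I_d.+1) c s x : i != j ->
  c ^+ 2 + s ^+ 2 = 1 -> sphere d (plane_rot i j c s x) <-> sphere d x.
Proof.
move=> ij cs; rewrite /sphere/=.
under eq_bigr do rewrite plane_rotE.
by rewrite sqr_rot_coord.
Qed.

Lemma measurable_rV_coord n (i : 'I_n) :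
  measurable_fun setT (fun x : 'rV[R]_n => x ord0 i : R).
Proof.
move=> _ Y mY; rewrite setTI; apply: sub_sigma_algebra => /=.
case: n i => [[]//|n] i.
rewrite -bigcup_mkord_ord; exists i; first exact: ltn_ord.
by exists Y => //; rewrite setTI inord_val.
Qed.

Lemma measurable_sphere d : measurable (sphere d : set 'rV[R]_d.+1).
Proof.
have mf : measurable_fun setT
    (fun x : 'rV[R]_d.+1 => \sum_(i < d.+1) x ord0 i ^+ 2 : R).
  apply: measurable_sum => i; apply: measurable_funX.
  exact: measurable_rV_coord.
have := mf measurableT [set 1] (measurable_set1 1).
by rewrite setTI.
Qed.

Lemma measurable_rot n (i j : 'I_n) c s :
  measurable_fun setT (plane_rot i j c s : 'rV[R]_n -> 'rV[R]_n).
Proof.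
apply: measurable_fun_rV => k; under eq_fun => x do rewrite plane_rotE
  /rot_coord.
case: (k == i).
  by apply: measurable_funB; apply: measurable_funM => //;
    exact: measurable_rV_coord.
case: (k == j); last exact: measurable_rV_coord.
by apply: measurable_funD; apply: measurable_funM => //;
    exact: measurable_rV_coord.
Qed.

Definition rot_tuple n (i j : 'I_n) (c s : R) (t : n.-tuple mR) : n.-tuple mR :=
  [tuple rot_coord i j c s (tnth t) k | k < n].

(* [s / (1 + c)] is the tangent of the half angle. *)
Lemma rot_tuple_shear n (i j : 'I_n) c s t : i != j -> 1 + c != 0 ->
  c ^+ 2 + s ^+ 2 = 1 ->
  let h := fun t : n.-tuple mR => - (s / (1 + c)) * tnth t j in
  rot_tuple i j c s t =
  shear i h (shear j (fun t => s * tnth t i) (shear i h t)).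
Proof.
move=> ij c0 cs h; apply: eq_from_tnth => k.
have ji : (j == i) = false by rewrite eq_sym (negbTE ij).
have s2 : s * s = (1 - c) * (1 + c).
  have -> : (1 - c) * (1 + c) = 1 - c ^+ 2 by ring.
  by rewrite -cs; ring.
have sE : s * (s / (1 + c)) = 1 - c by rewrite mulrA s2 mulfK.
have uE : (s / (1 + c)) * c = s - s / (1 + c).
  by apply: (mulIf c0); rewrite mulrBl mulrAC !divfK// mulrDr mulr1 addrAC
    subrr add0r.
rewrite tnth_mktuple /rot_coord !tnth_mktuple /h !tnth_mktuple !eqxx ji.
case: (eqVneq k i) => [->|ki]; rewrite ?(negbTE ij).
  set u := s / (1 + c) in sE uE *.
  set xi := tnth t i; set xj := tnth t j.
  transitivity ((1 - s * u) * xi - (u + (1 - s * u) * u) * xj); last by ring.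
  rewrite sE; transitivity (c * xi - (u + u * c) * xj); last by ring.
  by rewrite uE; ring.
case: (eqVneq k j) => [->|kj]//=; rewrite ?ji.
transitivity (s * tnth t i + (1 - s * (s / (1 + c))) * tnth t j); last by ring.
by rewrite sE; ring.
Qed.

Lemma lebesgue_tuple_rot n (i j : 'I_n) c s : i != j -> 1 + c != 0 ->
  c ^+ 2 + s ^+ 2 = 1 -> forall A, measurable A ->
  lebesgue_tuple R n (rot_tuple i j c s @^-1` A) = lebesgue_tuple R n A.
Proof.
move=> ij c0 cs A mA.
pose h := fun t : n.-tuple mR => - (s / (1 + c)) * tnth t j : mR.
pose g := fun t : n.-tuple mR => s * tnth t i : mR.
have mh : measurable_fun setT h.
  by apply: measurable_funM => //; exact: measurable_tnth.
have mg : measurable_fun setT g.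
  by apply: measurable_funM => //; exact: measurable_tnth.
have -> : rot_tuple i j c s @^-1` A =
    shear i h @^-1` (shear j g @^-1` (shear i h @^-1` A)).
  by apply/seteqP; split => t /=; rewrite rot_tuple_shear.
have hi t t' : (forall k, k != i -> tnth t k = tnth t' k) -> h t = h t'.
  by move=> tt'; rewrite /h tt'// eq_sym.
have gj t t' : (forall k, k != j -> tnth t k = tnth t' k) -> g t = g t'.
  by move=> tt'; rewrite /g tt'.
have mS k f : measurable_fun setT f -> forall B : set (n.-tuple mR),
    measurable B -> measurable (shear k f @^-1` B).
  by move=> mf B mB; rewrite -[X in measurable X]setTI; exact: measurable_shear.
have mA1 := mS i h mh _ mA; have mA2 := mS j g mg _ mA1.
by rewrite (lebesgue_tuple_shear mh hi mA2) (lebesgue_tuple_shear mg gj mA1)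
  (lebesgue_tuple_shear mh hi mA).
Qed.

Lemma surface_measureE d (A : set 'rV[R]_d.+1) :
  surface_measure d A = ((d.+1%:R)%:E * lebesgue_tuple R d.+1
    (@radial_proj R d.+1 @^-1` A `&` @unit_ball_tuple R d.+1))%E.
Proof. by []. Qed.

(** Radial projection commutes with the rotation and the unit ball is invariant, so the cone over
    the preimage of [A] is the preimage of the cone over [A]. *)
Lemma surface_measure_rot d (i j : 'I_d.+1) c s : i != j -> 1 + c != 0 ->
  c ^+ 2 + s ^+ 2 = 1 -> forall A : set 'rV[R]_d.+1, measurable A ->
  surface_measure d (plane_rot i j c s @^-1` A) = surface_measure d A.
Proof.
move=> ij c0 cs A mA; rewrite !surface_measureE; congr (_ * _)%E.
rewrite -[RHS](lebesgue_tuple_rot ij c0 cs); last first.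
  apply: measurableI; last exact: measurable_unit_ball_tuple.
  by rewrite -[X in measurable X]setTI; exact: measurable_radial_proj.
congr (lebesgue_tuple R d.+1 _).
have nE t : \sum_(k < d.+1) tnth (rot_tuple i j c s t) k ^+ 2 =
    \sum_(k < d.+1) tnth t k ^+ 2.
  by under eq_bigr do rewrite tnth_mktuple; rewrite sqr_rot_coord.
have rE t : plane_rot i j c s (radial_proj t) =
  radial_proj (rot_tuple i j c s t).
  apply/rowP => k; rewrite plane_rotE /rot_coord !mxE nE tnth_mktuple
    /rot_coord.
  by case: (k == i); [|case: (k == j)]; rewrite ?mulrBl ?mulrDl ?mulrA.
by apply/seteqP; split => t /= []; rewrite /unit_ball_tuple /= rE nE.
Qed.

Lemma surface_measure_lty d : (@surface_measure R d setT < +oo)%E.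
Proof.
rewrite surface_measureE preimage_setT setTI.
apply: lte_mul_pinfty => //.
pose B (i : 'I_d.+1) : set mR := `[-1, 1]%classic.
have mB i : measurable (B i) by exact: measurable_itv.
have le1 : (lebesgue_tuple R d.+1 (@unit_ball_tuple R d.+1) <=
    lebesgue_tuple R d.+1 [set t | forall i, B i (tnth t i)])%E.
  apply: le_measure; rewrite ?inE//.
  - exact: measurable_unit_ball_tuple.
  - exact: measurable_tuple_box.
  - move=> t; rewrite /unit_ball_tuple /= => t1 i; rewrite /B/= in_itv/=
      -ler_norml.
    rewrite -(@expr_le1 _ 2)// real_normK ?num_real//; apply: le_trans t1;
      rewrite (bigD1 i)//= lerDl.
    by apply: sumr_ge0 => k _; exact: sqr_ge0.
apply: le_lt_trans le1 _.
rewrite lebesgue_tuple_box// ltey_eq prode_fin_num// => i _.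
by rewrite lebesgue_measure_itv/=; case: ifP.
Qed.

End sphere_rotation.

(** * Integration on the sphere *)

Section sphere_integral_theory.
Context {R : realType} {d : nat}.
Local Notation mR := (measurableTypeR R).
Local Notation S := (sphere d : set 'rV[R]_d.+1).
Local Notation L := (@sphere_integral R d).
Implicit Types f g : 'rV[R]_d.+1 -> R.

(** The working class of integrands: an algebra, contained in L^1 because the measure is finite, and
    containing the polynomials and the members of H^s. *)
Definition bdmeas f : Prop :=
  measurable_fun S f /\ exists M, forall x, S x -> `|f x| <= M.

Definition dotrow (x y : 'rV[R]_d.+1) : R := \sum_i x ord0 i * y ord0 i.

Lemma sphere_measure_lty : (@surface_measure R d S < +oo)%E.
Proof.
apply: le_lt_trans (surface_measure_lty d); apply: le_measure; rewrite ?inE//.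
exact: measurable_sphere.
Qed.

Lemma bdmeas_integrable f :
  bdmeas f -> (surface_measure d).-integrable S (EFin \o f).
Proof.
move=> [mf [M fM]]; apply: measurable_bounded_integrable => //.
- exact: measurable_sphere.
- exact: sphere_measure_lty.
- exists M; split; first exact: num_real.
  by move=> K MK x Sx /=; apply: le_trans (fM x Sx) _; exact: ltW.
Qed.

Lemma bdmeas_cst (r : R) : bdmeas (fun=> r).
Proof. by split; [exact: measurable_cst|exists `|r|]. Qed.

Lemma bdmeasD f g : bdmeas f -> bdmeas g -> bdmeas (fun x => f x + g x).
Proof.
move=> [mf [M fM]] [mg [N gN]]; split; first exact: measurable_funD.
exists (M + N) => x Sx; apply: le_trans (ler_normD _ _) _.
by apply: lerD; [exact: fM|exact: gN].
Qed.

Lemma bdmeasM f g : bdmeas f -> bdmeas g -> bdmeas (fun x => f x * g x).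
Proof.
move=> [mf [M fM]] [mg [N gN]]; split; first exact: measurable_funM.
exists (M * N) => x Sx; rewrite normrM.
by apply: ler_pM => //; [exact: fM|exact: gN].
Qed.

Lemma bdmeasZ r f : bdmeas f -> bdmeas (fun x => r * f x).
Proof. exact/bdmeasM/bdmeas_cst. Qed.

Lemma bdmeasB f g : bdmeas f -> bdmeas g -> bdmeas (fun x => f x - g x).
Proof.
move=> bf bg; rewrite (_ : (fun _ => _) = fun x => f x + -1 * g x).
  exact/bdmeasD/bdmeasZ.
by apply/funext => x; rewrite mulN1r.
Qed.

Lemma bdmeasX n f : bdmeas f -> bdmeas (fun x => f x ^+ n).
Proof.
move=> bf; elim: n => [|n IHn].
  exact: bdmeas_cst.
by under eq_fun do rewrite exprS; apply: bdmeasM.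
Qed.

Lemma bdmeas_sum (I : Type) (r : seq I) (P : pred I)
    (F : I -> 'rV[R]_d.+1 -> R) :
  (forall i, bdmeas (F i)) -> bdmeas (fun x => \sum_(i <- r | P i) F i x).
Proof.
move=> bF; elim: r => [|i r IHr].
  by under eq_fun do rewrite big_nil; exact: bdmeas_cst.
under eq_fun do rewrite big_cons.
by case: (P i) => //; apply: (bdmeasD (bF i)).
Qed.

Lemma eq_bdmeas f g : (forall x, S x -> f x = g x) -> bdmeas f -> bdmeas g.
Proof.
move=> fg [mf [M fM]]; split.
  by apply: eq_measurable_fun mf => x /set_mem/fg.
by exists M => x Sx; rewrite -fg//; exact: fM.
Qed.

Lemma sqr_coord_sphere x : S x -> forall i, x ord0 i ^+ 2 <= 1.
Proof.
rewrite /sphere /= => <- i; rewrite (bigD1 i)//= lerDl.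
by apply: sumr_ge0 => j _; exact: sqr_ge0.
Qed.

Lemma norm_coord_sphere x : S x -> forall i, `|x ord0 i| <= 1.
Proof.
move=> Sx i; rewrite -(@expr_le1 _ 2)// real_normK ?num_real//.
exact: sqr_coord_sphere.
Qed.

Lemma bdmeas_coord (i : 'I_d.+1) : bdmeas (fun x => x ord0 i).
Proof.
split; last by exists 1 => x Sx; exact: norm_coord_sphere.
by apply: measurable_funTS; exact: measurable_rV_coord.
Qed.

Lemma bdmeas_dotrow y : bdmeas (fun x => dotrow x y).
Proof.
by apply: bdmeas_sum => i; apply: bdmeasM; [exact: bdmeas_coord|exact:
  bdmeas_cst].
Qed.

Lemma eq_sphere_integral f g : (forall x, S x -> f x = g x) -> L f = L g.
Proof. by move=> fg; apply: eq_Rintegral => x /set_mem/fg. Qed.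

Lemma sphere_integralZ r f : bdmeas f -> L (fun x => r * f x) = r * L f.
Proof.
move=> bf; rewrite /sphere_integral RintegralZl//.
  exact: measurable_sphere.
exact: bdmeas_integrable.
Qed.

Lemma sphere_integralD f g :
  bdmeas f -> bdmeas g -> L (fun x => f x + g x) = L f + L g.
Proof.
move=> bf bg; rewrite /sphere_integral RintegralD//.
  exact: measurable_sphere.
all: exact: bdmeas_integrable.
Qed.

Lemma sphere_integralB f g :
  bdmeas f -> bdmeas g -> L (fun x => f x - g x) = L f - L g.
Proof.
move=> bf bg; rewrite /sphere_integral RintegralB//.
  exact: measurable_sphere.
all: exact: bdmeas_integrable.
Qed.

Lemma sphere_integral0 : L (fun=> 0) = 0.
Proof. by rewrite /sphere_integral Rintegral_cst ?mul0r//; exact: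
  measurable_sphere. Qed.

Lemma sphere_integral_sum (I : Type) (r : seq I) (P : pred I)
    (F : I -> 'rV[R]_d.+1 -> R) : (forall i, bdmeas (F i)) ->
  L (fun x => \sum_(i <- r | P i) F i x) = \sum_(i <- r | P i) L (F i).
Proof.
move=> bF; elim: r => [|i r IHr].
  by rewrite big_nil -[RHS]sphere_integral0; apply: eq_sphere_integral => x _;
    rewrite big_nil.
rewrite big_cons -IHr; transitivity (L (fun x =>
    if P i then F i x + \sum_(j <- r | P j) F j x else \sum_(j <- r | P j) F j
      x)).
  by apply: eq_sphere_integral => x _; rewrite big_cons.
by case: (P i) => //; apply: sphere_integralD => //; exact: bdmeas_sum.
Qed.

Lemma sphere_integral_cst r : L (fun=> r) = r * L (fun=> 1).
Proof.
by rewrite -sphere_integralZ; [apply: eq_sphere_integral => x _;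
  rewrite mulr1|exact: bdmeas_cst].
Qed.

Lemma sphere_integral_ge0 f : (forall x, S x -> 0 <= f x) -> 0 <= L f.
Proof. exact: Rintegral_ge0. Qed.

Lemma le_sphere_integral f g : bdmeas f -> bdmeas g ->
  (forall x, S x -> f x <= g x) -> L f <= L g.
Proof.
move=> bf bg fg; apply: le_Rintegral => //.
  exact: measurable_sphere.
all: exact: bdmeas_integrable.
Qed.

Lemma le_norm_sphere_integral M f : bdmeas f -> (forall x, S x -> `|f x| <=
  M) ->
  `|L f| <= M * L (fun=> 1).
Proof.
move=> bf fM; rewrite -sphere_integral_cst ler_norml.
rewrite sphere_integral_cst -mulNr -!sphere_integral_cst.
apply/andP; split; apply: le_sphere_integral => //; try exact: bdmeas_cst.
  by move=> x /fM; rewrite ler_norml => /andP[].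
by move=> x /fM; rewrite ler_norml => /andP[].
Qed.


(** Change of variables for an image measure, which asks for measurability on the whole space; it is
    applied to polynomials. *)
Lemma sphere_integral_rot (i j : 'I_d.+1) c s f : i != j -> 1 + c != 0 ->
  c ^+ 2 + s ^+ 2 = 1 -> measurable_fun setT f -> bdmeas f ->
  bdmeas (fun x => f (plane_rot i j c s x)) ->
  L (fun x => f (plane_rot i j c s x)) = L f.
Proof.
move=> ij c0 cs mf bf bfr; rewrite /sphere_integral /Rintegral; congr fine.
pose mu := @surface_measure R d.
pose phi : 'rV[R]_d.+1 -> 'rV[R]_d.+1 := plane_rot i j c s.
have SE : phi @^-1` S = S.
  by apply/seteqP; split => x; [move/(sphere_rot _ ij cs)|move=> ?;
    apply/(sphere_rot _ ij cs)].
have mphi : measurable_fun setT phi by exact: measurable_rot.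
have E1 : (\int[mu]_(x in S) (f x)%:E =
    \int[pushforward mu phi]_(x in S) (f x)%:E)%E.
  apply: eq_measure_integral => A mA _.
  by rewrite /pushforward; apply/esym/surface_measure_rot.
apply: etrans (esym E1).
have mEf : measurable_fun setT (EFin \o f) by apply/measurable_EFinP.
have If : mu.-integrable (phi @^-1` S) ((EFin \o f) \o phi).
  by rewrite SE; exact: (bdmeas_integrable bfr).
have E2 := integral_pushforward mphi mEf If (@measurable_sphere R d).
by apply: etrans (esym E2); rewrite SE; reflexivity.
Qed.

End sphere_integral_theory.

(** * Spherical caps and polynomials peaking at a point *)

Section sphere_caps.
Context {R : realType} {d : nat}.
Local Notation mR := (measurableTypeR R).
Local Notation S := (sphere d : set 'rV[R]_d.+1).
Local Notation L := (@sphere_integral R d).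

Definition cap (x0 : 'rV[R]_d.+1) (e : R) : set 'rV[R]_d.+1 :=
  [set x | 1 - e < dotrow x x0].

Lemma measurable_cap x0 e : measurable (cap x0 e).
Proof.
have mf : measurable_fun setT (fun x : 'rV[R]_d.+1 => dotrow x x0 : R).
  apply: measurable_sum => i; apply: measurable_funM => //.
  exact: measurable_rV_coord.
have := mf measurableT `]1 - e, +oo[%classic (measurable_itv _).
rewrite setTI; congr measurable; apply/seteqP.
by split => x /=; rewrite in_itv/= andbT.
Qed.

Lemma dotrow_sphere_le1 x y : S x -> S y -> `|dotrow x y| <= 1.
Proof.
rewrite /sphere /dotrow /= => Sx Sy.
(* For s = 1 and s = -1, expand |x - s y|^2 = 2 - 2 s <x, y>. *)
have : forall s : R, s ^+ 2 = 1 ->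
    2 * (s * \sum_i x ord0 i * y ord0 i) <= 2.
  move=> s s1; rewrite -[leRHS]addr0 -lerBlDl.
  have -> : 2 * (s * \sum_i x ord0 i * y ord0 i) - 2 =
      - \sum_i (x ord0 i - s * y ord0 i) ^+ 2.
    transitivity (- \sum_i (x ord0 i ^+ 2 + y ord0 i ^+ 2 +
        - (2 * s) * (x ord0 i * y ord0 i))).
      by rewrite !big_split/= Sx Sy -mulr_sumr; ring.
    congr (- _); apply: eq_bigr => i _.
    by rewrite sqrrB exprMn s1 mul1r; ring.
  by rewrite oppr_le0; apply: sumr_ge0 => i _; exact: sqr_ge0.
move=> H; rewrite ler_norml.
have := H 1 (expr1n _ _); have := H (-1) (etrans (sqrrN 1) (expr1n _ _)).
by rewrite mul1r mulN1r => ? ?; apply/andP; split; lra.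
Qed.

(** On the cube around x0 / 2 one has <t, x0> >= 1/2 - h and |t| <= 1/2 + h, so the cosine of the
    angle with [x0] exceeds 1 - 8 h. With h <= 1/4 the cube avoids the origin and stays in the unit
    ball. Its volume is what makes caps have positive measure. *)
Lemma box_sub_cone x0 (h : R) : S x0 -> 0 < h -> h <= 1 / 4 ->
  [set t : d.+1.-tuple mR | forall i,
    `]x0 ord0 i / 2 - h / d.+1%:R, x0 ord0 i / 2 + h / d.+1%:R[%classic
      (tnth t i)]
  `<=` @radial_proj R d.+1 @^-1` (S `&` cap x0 (8 * h))
    `&` @unit_ball_tuple R d.+1.
Proof.
move=> Sx0 h0 h4; set n : R := d.+1%:R; move=> t /= tB.
have n0 : 0 < n by rewrite ltr0n.
have n1 : 1 <= n by rewrite ler1n.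
pose e i : R := (tnth t i : R) - x0 ord0 i / 2.
have eh i : `|e i| <= h / n.
  have : (x0 ord0 i / 2 - h / n < (tnth t i : R)) &&
      ((tnth t i : R) < x0 ord0 i / 2 + h / n).
    by have := tB i; rewrite in_itv.
  rewrite /e; generalize (tnth t i : R) => z /andP[l1 l2].
  by rewrite ler_norml; move: l1 l2; set w := h / n => l1 l2; apply/andP;
    split; lra.
have x01 i : `|x0 ord0 i| <= 1 by exact: norm_coord_sphere.
have sumh : \sum_(i < d.+1) h / n = h.
  by rewrite sumr_const card_ord -[_ *+ _]mulr_natr divfK// gt_eqF.
pose X := \sum_i x0 ord0 i * e i.
have Xh : `|X| <= h.
  apply: le_trans (ler_norm_sum _ _ _) _; rewrite -sumh.
  by apply: ler_sum => i _; rewrite normrM -[leRHS]mul1r; exact: ler_pM.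
pose E2 := \sum_i e i ^+ 2.
have E2h : E2 <= h ^+ 2.
  have -> : h ^+ 2 = \sum_(i < d.+1) (h / n) * h.
    by rewrite -mulr_suml sumh expr2.
  apply: ler_sum => i _; rewrite -[e i ^+ 2]real_normK ?num_real// expr2.
  apply: ler_pM => //; apply: le_trans (eh i) _.
  by rewrite ler_pdivrMr// ler_peMr// ltW.
have E20 : 0 <= E2 by apply: sumr_ge0 => i _; exact: sqr_ge0.
have tE i : tnth t i = x0 ord0 i / 2 + e i by rewrite /e addrC subrK.
have sE : \sum_(i < d.+1) tnth t i ^+ 2 = 1 / 4 + X + E2.
  under eq_bigr => i _.
    rewrite tE (_ : _ ^+ 2 =
      1 / 4 * x0 ord0 i ^+ 2 + x0 ord0 i * e i + e i ^+ 2); last by field.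
    over.
  by rewrite !big_split/= -mulr_sumr Sx0 mulr1.
have dE : \sum_(i < d.+1) tnth t i * x0 ord0 i = 1 / 2 + X.
  under eq_bigr => i _.
    rewrite tE (_ : _ * _ = 1 / 2 * x0 ord0 i ^+ 2 + x0 ord0 i * e i);
      last by field.
    over.
  by rewrite !big_split/= -mulr_sumr Sx0 mulr1.
move: Xh; rewrite ler_norml => /andP[X1 X2].
set s2 := \sum_(i < d.+1) tnth t i ^+ 2 in sE *.
have s20 : 0 < s2.
  have p : 0 < dotrow (\row_i tnth t i) x0.
    by rewrite /dotrow; under eq_bigr do rewrite mxE; rewrite dE; lra.
  rewrite lt_def sumr_ge0 ?andbT; last by move=> i _; exact: sqr_ge0.
  apply: contraTneq p => s0; rewrite -leNgt /dotrow big1// => i _.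
  rewrite mxE; have /psumr_eq0P-/(_ _ i isT)/eqP := s0.
  rewrite sqrf_eq0 => H; rewrite (eqP (H _)) ?mul0r// => j _; exact: sqr_ge0.
set r := Num.sqrt s2.
have r0 : 0 < r by rewrite sqrtr_gt0.
have rr : r ^+ 2 = s2 by rewrite sqr_sqrtr// ltW.
have rh : r <= 1 / 2 + h.
  have h12 : 0 <= 1 / 2 + h by lra.
  rewrite -(@ler_pXn2r _ 2)// ?nnegrE//; last exact: ltW.
  by rewrite rr sE (_ : (1 / 2 + h) ^+ 2 = 1 / 4 + h + h ^+ 2); [lra|field].
split.
  split => /=.
    rewrite /sphere/=; under eq_bigr do rewrite mxE expr_div_n -/s2 -/r rr.
    by rewrite -mulr_suml -/s2 divff// gt_eqF.
  rewrite /cap /= /dotrow; under eq_bigr do rewrite mxE -/s2 -/r mulrAC.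
  by rewrite -mulr_suml dE ltr_pdivlMr//; nra.
rewrite /unit_ball_tuple /= -/s2 -rr.
by rewrite expr_le1// ?ltW//; lra.
Qed.

Lemma cap_integral_gt0 x0 e : S x0 -> 0 < e -> 0 < L (\1_(cap x0 e) : _ -> R).
Proof.
move=> Sx0 e0.
pose h := Num.min (e / 8) (1 / 4).
have h0 : 0 < h by rewrite lt_min; apply/andP; split; lra.
have h4 : h <= 1 / 4 by rewrite ge_min lexx orbT.
have he : 8 * h <= e.
  by rewrite -ler_pdivlMl// mulrC ge_min lexx.
rewrite /sphere_integral /Rintegral integral_indic; last 2 first.
- exact: measurable_sphere.
- exact: measurable_cap.
have mCS : measurable (cap x0 e `&` S).
  by apply: measurableI; [exact: measurable_cap|exact: measurable_sphere].
apply: fine_gt0; apply/andP; split; last first.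
  apply: le_lt_trans (surface_measure_lty d).
  by apply: le_measure; rewrite ?inE.
rewrite surface_measureE mule_gt0//.
pose B i : set mR :=
  `]x0 ord0 i / 2 - h / d.+1%:R, x0 ord0 i / 2 + h / d.+1%:R[%classic.
have mB i : measurable (B i) by exact: measurable_itv.
apply: (@lt_le_trans _ _ (lebesgue_tuple R d.+1
    [set t | forall i, B i (tnth t i)])).
  rewrite lebesgue_tuple_box//.
  rewrite (eq_bigr (fun=> (2 * (h / d.+1%:R))%:E)); last first.
    move=> i _; rewrite lebesgue_measure_itv/= lte_fin.
    have p : 0 < h / d.+1%:R by rewrite divr_gt0// ltr0n.
    move: p; set w := h / d.+1%:R => p.
    rewrite ifT; last by rewrite ltrD2l; lra.
    by rewrite -EFinD; congr (_%:E); lra.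
  rewrite prodEFin lte_fin; apply: prodr_gt0 => i _.
  by rewrite mulr_gt0// divr_gt0// ltr0n.
apply: le_measure; rewrite ?inE//.
- exact: measurable_tuple_box.
- apply: measurableI; last exact: measurable_unit_ball_tuple.
  by rewrite -[X in measurable X]setTI; exact: measurable_radial_proj.
- move=> t tB; have [[? Ct] ?] := box_sub_cone Sx0 h0 h4 tB.
  split => //; split => //; move: Ct; rewrite /cap /=; apply: le_lt_trans.
  by rewrite lerB.
Qed.

Lemma bdmeas_indic (A : set 'rV[R]_d.+1) : measurable A ->
  bdmeas (\1_A : 'rV[R]_d.+1 -> R).
Proof.
move=> mA; split; first by apply: measurable_funTS; exact: measurable_indic.
by exists 1 => x _; rewrite indicE; case: (_ \in _); rewrite ?normr0 ?normr1.
Qed.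

Definition peak (x0 : 'rV[R]_d.+1) (D : nat) (x : 'rV[R]_d.+1) : R :=
  (2^-1 * (1 + dotrow x x0)) ^+ D.

Lemma bdmeas_peak x0 D : bdmeas (peak x0 D).
Proof.
by apply/bdmeasX/bdmeasZ/bdmeasD; [exact: bdmeas_cst|exact: bdmeas_dotrow].
Qed.

(* On the inner cap the peak exceeds [(1 - e / 4) ^+ D], off the outer one it is
   at most [(1 - e / 2) ^+ D], which is negligible for [D] large. *)
Lemma peak_integral_gt0 x0 (e eta B : R) : S x0 -> 0 < e -> e <= 1 -> 0 < eta ->
  exists D, forall r, bdmeas r -> (forall x, S x -> `|r x| <= B) ->
    (forall x, S x -> cap x0 e x -> eta <= r x) ->
    0 < L (fun x => r x * peak x0 D x).
Proof.
move=> Sx0 e0 e1 eta0.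
set k := L (\1_(cap x0 (e / 2)) : _ -> R).
have k0 : 0 < k by apply: cap_integral_gt0 => //; lra.
set a := L (fun=> 1).
have a0 : 0 <= a by apply: sphere_integral_ge0.
(* Ratio of the bounds of the peak outside the outer cap and inside the inner one, before taking the
   power [D]. *)
pose q := (1 - e / 2) / (1 - e / 4).
have q4 : 0 < 1 - e / 4 by lra.
have q0 : 0 <= q by rewrite divr_ge0//; lra.
have q1 : `|q| < 1 by rewrite ger0_norm// ltr_pdivrMr//; lra.
have [D HD] : exists D, (`|B| * a) * q ^+ D < eta * k.
  have H : (fun D => (`|B| * a) * q ^+ D) @ \oo --> (`|B| * a) * 0.
    by apply: cvgMr; exact: cvg_expr.
  rewrite mulr0 in H; have ek : 0 < eta * k by rewrite mulr_gt0.
  have [D _ /(_ D (leqnn D))] := cvgr_lt ((0 : R)) H _ ek.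
  by exists D.
exists D => r br rB rC.
have qE : q ^+ D * (1 - e / 4) ^+ D = (1 - e / 2) ^+ D.
  by rewrite -exprMn divfK// gt_eqF.
(* A minorant with explicit integral. Between the two caps the product is nonnegative because r >=
   eta > 0 there. *)
have lb x : S x -> (eta * (1 - e / 4) ^+ D) * \1_(cap x0 (e / 2)) x
    - `|B| * (1 - e / 2) ^+ D <= r x * peak x0 D x.
  move=> Sx; have := dotrow_sphere_le1 Sx Sx0.
  rewrite ler_norml => /andP[l1 l2].
  have p0 : 0 <= peak x0 D x by apply: exprn_ge0; lra.
  have B0 : 0 <= `|B| * (1 - e / 2) ^+ D.
    by rewrite mulr_ge0// exprn_ge0//; lra.
  have [xC|xC] := pselect (cap x0 e x).
    have rx := rC x Sx xC.
    have rp0 : 0 <= r x * peak x0 D x by rewrite mulr_ge0//; lra.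
    rewrite indicE; case: (boolP (x \in _)) => [/set_mem xC2|_]; last first.
      by rewrite mulr0 sub0r; lra.
    rewrite mulr1 lerBlDr; apply: le_trans (_ : r x * peak x0 D x <= _);
      last by rewrite lerDl.
    apply: ler_pM => //; first exact: ltW.
      by rewrite exprn_ge0// ltW.
    rewrite /peak lerXn2r ?nnegrE//; first exact: ltW.
      by move: xC2; rewrite /cap/=; lra.
    by move: xC2; rewrite /cap/=; lra.
  rewrite indicE memNset; last by move: xC; rewrite /cap/= => /negP;
    rewrite -leNgt => ? ; lra.
  rewrite mulr0 sub0r.
  apply: le_trans (_ : - (`|r x| * peak x0 D x) <= _); last first.
    rewrite -mulNr; apply: ler_wpM2r => //.
    by rewrite lerNl -normrN ler_norm.
  rewrite lerN2; apply: ler_pM => //.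
    exact: le_trans (rB x Sx) (ler_norm _).
  rewrite /peak lerXn2r ?nnegrE//; move/negP: xC; rewrite -leNgt; lra.
have bl : bdmeas (fun x => (eta * (1 - e / 4) ^+ D) * \1_(cap x0 (e / 2)) x
    - `|B| * (1 - e / 2) ^+ D).
  apply: bdmeasB; last exact: bdmeas_cst.
  by apply/bdmeasZ/bdmeas_indic; exact: measurable_cap.
apply: lt_le_trans (le_sphere_integral bl (bdmeasM br (bdmeas_peak x0 D)) lb).
rewrite sphere_integralB; last exact: bdmeas_cst.
  rewrite sphere_integralZ; last by apply/bdmeas_indic; exact: measurable_cap.
  rewrite -/k sphere_integral_cst -/a -qE.
  rewrite (_ : _ - _ = (eta * k - `|B| * a * q ^+ D) * (1 - e / 4) ^+ D);
    last by ring.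
  by rewrite mulr_gt0 ?exprn_gt0// subr_gt0.
by apply/bdmeasZ/bdmeas_indic; exact: measurable_cap.
Qed.

End sphere_caps.

(** * Harmonic polynomials *)

Section harmonic_polynomials.
Import -(notations) mpoly.
Context {R : realType} {n : nat}.
Local Notation poly := (mpoly n R).
Local Notation Xv i := (mpolyX R (mnm1 i) : poly).
Local Notation homog k := (ishomog1 k (@mdeg n)).
Implicit Types p q g r : poly.

Definition laplacian p : poly := \sum_i mderiv i (mderiv i p).

Definition sqnorm_poly : poly := \sum_i Xv i * Xv i.

(** Suits properties that pass to sums and products, such as a first order expansion. *)
Lemma mpoly_alg_ind (P : poly -> Prop) :
  (forall c, P (mpolyC n c)) -> (forall i, P (Xv i)) ->
  (forall p q, P p -> P q -> P (p + q)) ->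
  (forall p q, P p -> P q -> P (p * q)) -> forall p, P p.
Proof.
move=> PC PX PD PM p; elim/mpolyind: p => [|c m p _ _ Pp].
  by rewrite -[0]/(0 : poly) -(mpolyC0 n R); exact: PC.
apply: PD => //; rewrite -mul_mpolyC; apply: (PM _ _ (PC c)).
rewrite mpolyXE_id; elim/big_ind: _ => //.
  exact: (PC 1).
move=> i _; elim: (m i) => [|k IHk]; first by rewrite expr0; exact: (PC 1).
by rewrite exprS; exact: PM.
Qed.

Lemma mderiv_mpolyXU i j : mderiv i (Xv j) = ((i == j)%:R : poly).
Proof.
rewrite mderivX mnm1E eq_sym; case: eqVneq => [->|_]; last by rewrite scale0r.
rewrite scale1r (_ : mnm_sub _ _ = mnm0) ?mpolyX0//.
by apply/mnmP => k; rewrite mnmBE subnn mnm0E.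
Qed.

Lemma homog_mderiv i k p : p \is homog k -> mderiv i p \is homog k.-1.
Proof.
move=> /dhomogP hp; apply/dhomogP => m; rewrite mcoeff_msupp mcoeff_mderiv => H.
have : mnm_add m (mnm1 i) \in msupp p.
  by rewrite mcoeff_msupp; apply: contraNneq H => ->; rewrite mul0rn.
by move=> /hp /=; rewrite mdegD mdeg1 addn1 => <-.
Qed.

Lemma homog0_mderiv i p : p \is homog 0 -> mderiv i p = 0.
Proof.
move=> /dhomogP hp; apply/mpolyP => m; rewrite mcoeff_mderiv mcoeff0.
case: (boolP (mnm_add m (mnm1 i) \in msupp p)) => [/hp/=|/memN_msupp_eq0->].
  by rewrite mdegD mdeg1 addn1.
by rewrite mul0rn.
Qed.

Lemma euler_homog k p : p \is homog k -> \sum_i Xv i * mderiv i p = p *+ k.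
Proof.
move=> /dhomogP hp.
have E m : \sum_i Xv i * mderiv i (mpolyX R m) = mpolyX R m *+ mdeg m.
  rewrite mdegE -sumrMnr; apply: eq_bigr => i _.
  rewrite mderivX scaler_nat mulrnAr; case: (posnP (m i)) => [->|mi0].
    by rewrite !mulr0n.
  rewrite -mpolyXD addmC submK//.
  by apply/mnm_lepP => j; rewrite mnm1E; case: eqP => [<-|_].
rewrite [in RHS](mpolyE p) -sumrMnl.
under eq_bigr => i _ do rewrite [in X in _ * X](mpolyE p) raddf_sum mulr_sumr.
rewrite exchange_big /= big_seq [RHS]big_seq; apply: eq_bigr => m mp.
rewrite -(hp m mp) scalerMnr -E scaler_sumr.
by apply: eq_bigr => i _; rewrite mderivZ -scalerAr.
Qed.

Lemma homogM k l p q : p \is homog k -> q \is homog l ->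
  p * q \is homog (k + l).
Proof. exact: dhomogM. Qed.

Lemma homogXU i : Xv i \is homog 1.
Proof. by rewrite dhomogX /= mdeg1. Qed.

Lemma homog_sum (I : Type) (s : seq I) (P : pred I) k (F : I -> poly) :
  (forall i, P i -> F i \is homog k) -> \sum_(i <- s | P i) F i \is homog k.
Proof. exact: rpred_sum. Qed.

Lemma homog_sqnorm_poly : sqnorm_poly \is homog 2.
Proof. by apply: homog_sum => i _; apply: (@homogM 1 1); exact: homogXU. Qed.

Lemma homog_sqnorm_polyX j : sqnorm_poly ^+ j \is homog (2 * j).
Proof.
elim: j => [|j IHj]; first by rewrite expr0 muln0 dhomog1.
by rewrite exprS mulnS; apply: homogM => //; exact: homog_sqnorm_poly.
Qed.

Lemma laplacianD p q : laplacian (p + q) = laplacian p + laplacian q.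
Proof. by rewrite -big_split; apply: eq_bigr => i _; rewrite !mderivD. Qed.

Lemma laplacianZ c p : laplacian (c *: p) = c *: laplacian p.
Proof. by rewrite scaler_sumr; apply: eq_bigr => i _; rewrite !mderivZ. Qed.

Lemma laplacianB p q : laplacian (p - q) = laplacian p - laplacian q.
Proof. by rewrite -[q]opprK opprK -scaleN1r laplacianD laplacianZ scaleN1r. Qed.

Lemma homog_laplacian k p : p \is homog k -> laplacian p \is homog (k - 2).
Proof.
move=> hp; apply: homog_sum => i _; rewrite subn2.
by do 2 apply: homog_mderiv.
Qed.

Lemma laplacian_homog_lt2 k p : (k < 2)%N -> p \is homog k -> laplacian p = 0.
Proof.
case: k => [|[|//]] _ hp; apply: big1 => i _.
  by rewrite (homog0_mderiv i hp) mderiv0.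
by rewrite homog0_mderiv//; exact: (homog_mderiv i hp).
Qed.

Lemma mderiv_sqnorm_poly i : mderiv i sqnorm_poly = Xv i *+ 2.
Proof.
rewrite raddf_sum /= (bigD1 i)//= mderivM mderiv_mpolyXU eqxx mul1r mulr1.
rewrite big1 ?addr0 ?mulr2n// => j ji.
by rewrite mderivM mderiv_mpolyXU eq_sym (negbTE ji) mul0r mulr0 addr0.
Qed.

(** Leibniz: the Laplacian of |x|^2 is 2 n, and the cross term 2 <2 x, grad p> is 4 k p by Euler's
    identity. *)
Lemma laplacian_sqnormM k p : p \is homog k ->
  laplacian (sqnorm_poly * p) =
  p *+ (2 * n + 4 * k) + sqnorm_poly * laplacian p.
Proof.
move=> hp; rewrite mulrnDr (mulnC 4%N k) (mulrnA p k 4) -(euler_homog hp).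
have -> : p *+ (2 * n) = \sum_(i < n) p *+ 2.
  by rewrite sumr_const card_ord -mulrnA.
rewrite mulr_sumr -sumrMnl -!big_split; apply: eq_bigr => i _ /=.
rewrite mderivM mderiv_sqnorm_poly mderivD !mderivM mderiv_sqnorm_poly.
rewrite mderivMn mderiv_mpolyXU eqxx /=; ring.
Qed.

Lemma laplacian_sqnormXM j k p : p \is homog k ->
  laplacian (sqnorm_poly ^+ j.+1 * p) =
  (sqnorm_poly ^+ j * p) *+ (2 * j.+1 * (n + 2 * j + 2 * k))
  + sqnorm_poly ^+ j.+1 * laplacian p.
Proof.
move=> hp; elim: j => [|j IHj].
  rewrite expr1 expr0 mul1r (laplacian_sqnormM hp); congr (_ *+ _ + _).
  by rewrite muln0 addn0 muln1 mulnDr mulnA.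
rewrite exprS -mulrA.
rewrite (laplacian_sqnormM (homogM (homog_sqnorm_polyX j.+1) hp)) IHj.
rewrite mulrDr addrA mulrA -exprS; congr (_ + _).
rewrite mulrnAr mulrA -exprS -mulrnDr; congr (_ *+ _).
ring.
Qed.

(** Strong induction on [k], for all [j] at once: g / c solves the equation up to the error |x|^(2 j
    + 2) Delta g / c, a right-hand side of the same form with k - 2 and j + 1 in place of k and
    j. *)
Lemma laplacian_sqnorm_surj k j g : (0 < n)%N -> g \is homog k ->
  exists2 r, r \is homog k &
    laplacian (sqnorm_poly ^+ j.+1 * r) = sqnorm_poly ^+ j * g.
Proof.
move=> n0; elim/ltn_ind: k j g => k IHk j g hg.
pose c := (2 * j.+1 * (n + 2 * j + 2 * k))%N.
have c0 : c%:R != 0 :> R.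
  by rewrite pnatr_eq0 -lt0n !muln_gt0/= !addn_gt0 n0.
have E : laplacian (sqnorm_poly ^+ j.+1 * (c%:R^-1 *: g)) =
    sqnorm_poly ^+ j * g + sqnorm_poly ^+ j.+1 * (c%:R^-1 *: laplacian g).
  rewrite -!scalerAr laplacianZ (laplacian_sqnormXM j hg) scalerDr.
  have -> : (sqnorm_poly ^+ j * g) *+ (2 * j.+1 * (n + 2 * j + 2 * k)) =
      c%:R *: (sqnorm_poly ^+ j * g) by rewrite scaler_nat.
  by rewrite scalerA mulVf// scale1r.
have hcg : c%:R^-1 *: g \is homog k by exact: dhomogZ.
have [k2|k2] := ltnP k 2.
  exists (c%:R^-1 *: g) => //.
  by rewrite E (laplacian_homog_lt2 k2 hg) scaler0 mulr0 addr0.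
have hl : c%:R^-1 *: laplacian g \is homog (k - 2).
  by apply: dhomogZ; exact: homog_laplacian.
have kk : (k - 2 < k)%N by rewrite ltn_subrL// (leq_trans _ k2).
have [r hr rE] := IHk _ kk j.+1 _ hl.
exists (c%:R^-1 *: g - sqnorm_poly * r).
  apply: rpredB => //; rewrite -(subnKC k2).
  by apply: homogM => //; exact: homog_sqnorm_poly.
by rewrite mulrBr laplacianB E mulrA -exprSr rE addrK.
Qed.

(** If |x|^2 r has the same Laplacian as [q], then q - |x|^2 r is harmonic. The last clause deals
    with k < 2, where the truncated k - 2 is 0 and a nonzero [r] would have the wrong degree. *)
Lemma harmonic_split k q : (0 < n)%N -> q \is homog k ->
  exists h r, [/\ h \is homog k, laplacian h = 0, r \is homog (k - 2),
    q = h + sqnorm_poly * r & (k < 2)%N -> r = 0].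
Proof.
move=> n0 hq; have [k2|k2] := ltnP k 2.
  exists q, 0; split => //; rewrite ?mulr0 ?addr0 ?dhomog0//.
  exact: (laplacian_homog_lt2 k2 hq).
have [r hr] := laplacian_sqnorm_surj 0 n0 (homog_laplacian hq).
rewrite expr1 expr0 mul1r => rE.
exists (q - sqnorm_poly * r), r; split => //.
- apply: rpredB => //; rewrite -(subnKC k2).
  by apply: homogM => //; exact: homog_sqnorm_poly.
- by rewrite laplacianB rE subrr.
- by rewrite subrK.
Qed.

Definition rotation_field (i j : 'I_n) p : poly :=
  Xv i * mderiv j p - Xv j * mderiv i p.

(** Combination of rotation fields chosen to isolate one partial derivative: restricted to the
    sphere, the right-hand side is d_j q minus a multiple of x_j q. *)
Lemma sum_rotation_field j k q : q \is homog k ->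
  \sum_i rotation_field i j (Xv i * q) =
  sqnorm_poly * mderiv j q - (Xv j * q) *+ k + (Xv j * q) - (Xv j * q) *+ n.
Proof.
move=> hq; have -> : (Xv j * q) *+ n = \sum_(i < n) Xv j * q.
  by rewrite sumr_const card_ord.
have -> : (Xv j * q) *+ k = \sum_i Xv j * (Xv i * mderiv i q).
  by rewrite -mulr_sumr (euler_homog hq) mulrnAr.
have E : Xv j * q = \sum_i Xv i * ((j == i)%:R * q).
  rewrite (bigD1 j)//= eqxx mul1r big1 ?addr0// => i ij.
  by rewrite eq_sym (negbTE ij) mul0r mulr0.
rewrite {1}E /sqnorm_poly mulr_suml -sumrB -big_split -sumrB; apply:
  eq_bigr => i _ /=.
by rewrite /rotation_field !mderivM !mderiv_mpolyXU eqxx /=; ring.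
Qed.

Lemma sum_mderiv_mderivM p q : laplacian p = 0 ->
  \sum_j mderiv j (mderiv j p * q) = \sum_j mderiv j p * mderiv j q.
Proof.
move=> lp; under eq_bigr do rewrite mderivM.
by rewrite big_split/= -mulr_suml -/(laplacian p) lp mul0r add0r.
Qed.

End harmonic_polynomials.

(** * Integration by parts and orthogonality for polynomials on the sphere *)

Section sphere_polynomials.
Import -(notations) mpoly.
Context {R : realType} {d : nat}.
Local Notation S := (sphere d : set 'rV[R]_d.+1).
Local Notation L := (@sphere_integral R d).
Local Notation poly := (mpoly d.+1 R).
Local Notation Xv i := (mpolyX R (mnm1 i) : poly).
Local Notation homog k := (ishomog1 k (@mdeg d.+1)).
Implicit Types p q : poly.

Definition peval p (x : 'rV[R]_d.+1) : R := meval (x ord0) p.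

Lemma pevalC c x : peval (mpolyC _ c) x = c. Proof. exact: mevalC. Qed.
Lemma pevalX i x : peval (Xv i) x = x ord0 i. Proof. exact: mevalXU. Qed.
Lemma peval0 x : peval 0 x = 0. Proof. exact: meval0. Qed.
Lemma pevalN p x : peval (- p) x = - peval p x. Proof. exact: mevalN. Qed.
Lemma pevalD p q x : peval (p + q) x = peval p x + peval q x.
Proof. exact: mevalD. Qed.
Lemma pevalM p q x : peval (p * q) x = peval p x * peval q x.
Proof. exact: mevalM. Qed.
Lemma pevalZ c p x : peval (c *: p) x = c * peval p x.
Proof. exact: mevalZ. Qed.
Lemma peval_sum (I : Type) (s : seq I) (P : pred I) (F : I -> poly) x :
  peval (\sum_(i <- s | P i) F i) x = \sum_(i <- s | P i) peval (F i) x.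
Proof. exact: raddf_sum. Qed.

Lemma peval_sqnorm_poly x : S x -> peval sqnorm_poly x = 1.
Proof.
move=> <-; rewrite peval_sum; apply: eq_bigr => i _.
by rewrite pevalM pevalX expr2.
Qed.

Lemma peval_ind (P : ('rV[R]_d.+1 -> R) -> Prop) :
  (forall c, P (fun=> c)) -> (forall i, P (fun x => x ord0 i)) ->
  (forall f g, P f -> P g -> P (fun x => f x + g x)) ->
  (forall f g, P f -> P g -> P (fun x => f x * g x)) ->
  forall p, P (peval p).
Proof.
move=> PC PX PD PM p.
elim/(@mpoly_alg_ind R d.+1): p => [c|i|p q Pp Pq|p q Pp Pq].
- by rewrite (funext (pevalC c)).
- by rewrite (funext (pevalX i)).
- by rewrite (funext (pevalD p q)); exact: PD.
- by rewrite (funext (pevalM p q)); exact: PM.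
Qed.

Lemma continuous_peval p : continuous (peval p).
Proof.
apply: (@peval_ind (fun f => continuous f)) => [c|i|f g cf cg|f g cf cg] x.
- exact: cst_continuous.
- exact: coord_continuous.
- exact: (continuousD (cf x) (cg x)).
- exact: (continuousM (cf x) (cg x)).
Qed.

Lemma measurable_peval p : measurable_fun setT (peval p).
Proof.
apply: (@peval_ind (measurable_fun setT)) => [c|i|f g mf mg|f g mf mg].
- exact: measurable_cst.
- exact: measurable_rV_coord.
- exact: measurable_funD.
- exact: measurable_funM.
Qed.

Lemma bdmeas_peval p : bdmeas (peval p).
Proof.
apply: (@peval_ind bdmeas) => [c|i|f g bf bg|f g bf bg].
- exact: bdmeas_cst.
- exact: bdmeas_coord.
- exact: bdmeasD.
- exact: bdmeasM.
Qed.

Lemma bdmeas_peval_rot p (i j : 'I_d.+1) c s : i != j ->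
  c ^+ 2 + s ^+ 2 = 1 -> bdmeas (fun x => peval p (plane_rot i j c s x)).
Proof.
move=> ij cs; have [_ [M pM]] := bdmeas_peval p; split.
  apply: measurable_funTS.
  by apply: (measurableT_comp (measurable_peval p)); exact: measurable_rot.
by exists M => x Sx; apply: pM; exact/(sphere_rot _ ij cs).
Qed.

Definition pint p : R := L (peval p).

Lemma pintD p q : pint (p + q) = pint p + pint q.
Proof.
rewrite /pint -sphere_integralD; try exact: bdmeas_peval.
by apply: eq_sphere_integral => x _; rewrite pevalD.
Qed.

Lemma pintZ c p : pint (c *: p) = c * pint p.
Proof.
rewrite /pint -sphere_integralZ; last exact: bdmeas_peval.
by apply: eq_sphere_integral => x _; rewrite pevalZ.
Qed.

Lemma pintB p q : pint (p - q) = pint p - pint q.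
Proof. by rewrite -scaleN1r pintD pintZ mulN1r. Qed.

Lemma pintMn p k : pint (p *+ k) = pint p *+ k.
Proof. by rewrite -scaler_nat pintZ mulr_natl. Qed.

Lemma pint_sum (I : Type) (s : seq I) (P : pred I) (F : I -> poly) :
  pint (\sum_(i <- s | P i) F i) = \sum_(i <- s | P i) pint (F i).
Proof.
rewrite /pint -sphere_integral_sum; last by move=> i; exact: bdmeas_peval.
by apply: eq_sphere_integral => x _; rewrite peval_sum.
Qed.

Lemma pint_sqnorm p : pint (sqnorm_poly * p) = pint p.
Proof.
by apply: eq_sphere_integral => x Sx; rewrite pevalM peval_sqnorm_poly// mul1r.
Qed.

Lemma rotation_fieldD i j p q :
  rotation_field i j (p + q) = rotation_field i j p + rotation_field i j q.
Proof. by rewrite /rotation_field !mderivD; ring. Qed.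

Lemma rotation_fieldM i j p q : rotation_field i j (p * q) =
  rotation_field i j p * q + p * rotation_field i j q.
Proof. by rewrite /rotation_field !mderivM; ring. Qed.

(* The rotation field generates the plane rotations: first order expansion at
   the identity, the angle being measured by its sine. *)
Lemma peval_rot_expansion (i j : 'I_d.+1) p : i != j ->
  exists2 C : R, 0 <= C & forall (c s : R) x, S x -> 0 <= c ->
    c ^+ 2 + s ^+ 2 = 1 ->
  `|peval p (plane_rot i j c s x) - peval p x
    - s * peval (rotation_field i j p) x| <= C * s ^+ 2.
Proof.
move=> ij.
have ji : (j == i) = false by rewrite eq_sym (negbTE ij).
elim/(@mpoly_alg_ind R d.+1): p => [a|k|p q [C C0 pC] [D D0 qD]|p q [C C0 pC]
  [D D0 qD]].
- exists 0 => // c s x _ _ _.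
  rewrite !pevalC /rotation_field !mderivC !mulr0 subrr.
  by rewrite subrr peval0 mulr0 subr0 normr0 mul0r.
- exists 1 => // c s x Sx c0 cs.
  rewrite !pevalX /rotation_field !mderiv_mpolyXU plane_rotE /rot_coord.
  have s0 := sqr_ge0 s.
  have c1 : c <= 1 by rewrite -(@expr_le1 _ 2)// -cs lerDl.
  (* This is where 0 <= c matters: 1 - c <= 1 - c^2 = s^2. *)
  have cS : `|c - 1| <= s ^+ 2.
    rewrite distrC ger0_norm ?subr_ge0// lerBlDr -cs [leRHS]addrC lerD2r.
    by rewrite expr2 ler_piMl.
  rewrite mul1r; case: (eqVneq k i) => [->|ki].
    rewrite ji/= mulr0 mulr1 sub0r pevalN pevalX.
    rewrite (_ : _ - _ = (c - 1) * x ord0 i); last by ring.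
    rewrite normrM -[leRHS]mulr1; apply: ler_pM => //.
    exact: norm_coord_sphere.
  case: (eqVneq k j) => [->|kj].
    rewrite /= mulr0 mulr1 subr0 pevalX.
    rewrite (_ : _ - _ = (c - 1) * x ord0 j); last by ring.
    rewrite normrM -[leRHS]mulr1; apply: ler_pM => //.
    exact: norm_coord_sphere.
  rewrite !mulr0 !subrr.
  by rewrite peval0 mulr0 subr0 normr0.
- exists (C + D); first exact: addr_ge0.
  move=> c s x Sx c0 cs; rewrite rotation_fieldD !(pevalD p q).
  rewrite (pevalD (rotation_field i j p)) mulrDl.
  apply: le_trans (lerD (pC c s x Sx c0 cs) (qD c s x Sx c0 cs)).
  apply: le_trans (ler_normD _ _); rewrite le_eqVlt; apply/orP; left.
  by apply/eqP; congr `|_|; ring.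
- have [_ [Mp pM]] := bdmeas_peval p.
  have [_ [Mq qM]] := bdmeas_peval q.
  have [_ [Np pN]] := bdmeas_peval (rotation_field i j p).
  have [_ [Nq qN]] := bdmeas_peval (rotation_field i j q).
  exists (C * `|Mq| + (`|Mp| + `|Np|) * D + `|Np| * `|Nq|).
    by rewrite !addr_ge0// mulr_ge0// addr_ge0.
  move=> c s x Sx c0 cs.
  have Sr : S (plane_rot i j c s x) by exact/(sphere_rot _ ij cs).
  have := pC c s x Sx c0 cs; have := qD c s x Sx c0 cs.
  have := le_trans (pM x Sx) (ler_norm _).
  have := le_trans (qM _ Sr) (ler_norm _).
  have := le_trans (pN x Sx) (ler_norm _).
  have := le_trans (qN x Sx) (ler_norm _).
  rewrite rotation_fieldM !(pevalM p q) (pevalD (_ * q)).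
  rewrite (pevalM (rotation_field i j p)) (pevalM p).
  set b := peval q (plane_rot _ _ _ _ _); set a :=
    peval p (plane_rot _ _ _ _ _).
  set a0 := peval p x; set b0 := peval q x.
  set a1 := peval (rotation_field i j p) x.
  set b1 := peval (rotation_field i j q) x.
  set e := a - a0 - s * a1; set f := b - b0 - s * b1 => Hb1 Ha1 Hb Ha0 Hf He.
  have s1 : `|s| <= 1.
    by rewrite -(@expr_le1 _ 2)// real_normK ?num_real// -cs lerDr sqr_ge0.
  (* Leibniz rule for expansions: with a = a0 + s a1 + e and b = b0 + s b1 + f, this is the
     remainder of a b. The constant given above bounds its three terms in this order. *)
  rewrite (_ : _ - _ - _ = e * b + (a0 + s * a1) * f + s ^+ 2 * (a1 * b1));
    last by rewrite /e /f; ring.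
  rewrite (_ : _ * s ^+ 2 = C * s ^+ 2 * `|Mq| + (`|Mp| + `|Np|) * (D * s ^+ 2)
    + s ^+ 2 * (`|Np| * `|Nq|)); last by ring.
  apply: le_trans (ler_normD _ _) (lerD _ _); last first.
    by rewrite normrM ger0_norm ?sqr_ge0// ler_wpM2l ?sqr_ge0// normrM ler_pM.
  apply: le_trans (ler_normD _ _) (lerD _ _); first by rewrite normrM ler_pM.
  rewrite normrM; apply: ler_pM => //.
  apply: le_trans (ler_normD _ _) (lerD Ha0 _).
  by rewrite normrM -[leRHS]mul1r; exact: ler_pM.
Qed.

(** By invariance the integral of p o rotation - p is 0, so the expansion leaves |s| times the
    integral of the field bounded by C s^2 times the area; divide by s and let it tend to 0. *)
Lemma pint_rotation_field (i j : 'I_d.+1) p : pint (rotation_field i j p) = 0.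
Proof.
have [<-|ij] := eqVneq i j.
  by rewrite /rotation_field subrr -(scale0r 0) pintZ mul0r.
have [C C0 pC] := peval_rot_expansion p ij.
set I := pint _; set a := L (fun=> 1).
have a0 : 0 <= a by exact: sphere_integral_ge0.
have H s : 0 < s -> s <= 1 -> `|I| <= C * a * s.
  move=> s0 s1; pose c := Num.sqrt (1 - s ^+ 2).
  have c0 : 0 <= c by exact: sqrtr_ge0.
  have cs : c ^+ 2 + s ^+ 2 = 1.
    by rewrite sqr_sqrtr ?subrK// subr_ge0 expr_le1// ltW.
  have br := bdmeas_peval_rot p ij cs.
  have bp := bdmeas_peval p; have bR := bdmeas_peval (rotation_field i j p).
  have := le_norm_sphere_integral (bdmeasB (bdmeasB br bp) (bdmeasZ s bR))
    (fun x Sx => pC c s x Sx c0 cs).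
  rewrite sphere_integralB; [|exact: bdmeasB|exact: bdmeasZ].
  rewrite sphere_integralB// sphere_integralZ// sphere_integral_rot//;
    [|by rewrite gt_eqF// ltr_pwDl|exact: measurable_peval].
  rewrite subrr sub0r normrN normrM gtr0_norm// -/a -/I.
  move=> H1; rewrite -(ler_pM2l s0); apply: le_trans H1 _.
  by rewrite le_eqVlt; apply/orP; left; apply/eqP; ring.
apply/eqP; rewrite -normr_le0 leNgt; apply/negP => I0.
(* Small enough that C a s <= |I| / 2, against [H]; the + 1 avoids a zero denominator. *)
pose s := Num.min 1 (`|I| / (2 * (C * a + 1))).
have Ca : 0 <= C * a by exact: mulr_ge0.
have s0 : 0 < s by rewrite lt_min ltr01/= divr_gt0//; lra.
have s1 : s <= 1 by rewrite ge_min lexx.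
have sI : s * (2 * (C * a + 1)) <= `|I|.
  by rewrite -ler_pdivlMr; [rewrite ge_min lexx orbT|lra].
have := H s s0 s1; nra.
Qed.

(** Integration by parts on the sphere: the mean of [sum_rotation_field] is 0 and |x|^2 = 1. There
    are d + 1 variables, hence the factor k + (d + 1) - 1. *)
Lemma pint_mderiv j k q : q \is homog k ->
  pint (mderiv j q) = (k + d)%:R * pint (Xv j * q).
Proof.
move=> hq; have : pint (\sum_i rotation_field i j (Xv i * q)) = 0.
  by rewrite pint_sum big1// => i _; rewrite pint_rotation_field.
rewrite (sum_rotation_field j hq) !pintB pintD pintB !pintMn pint_sqnorm.
rewrite natrD mulrDl !mulr_natl mulrS => /eqP; rewrite subr_eq0 => /eqP.
set u := pint _; set v := pint _ => E.
have -> : u = (u - v *+ k + v) + v *+ k - v by ring.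
by rewrite E; ring.
Qed.

Lemma pint_grad k l p q : p \is homog k -> q \is homog l -> laplacian p = 0 ->
  pint (\sum_j mderiv j p * mderiv j q) = ((k.-1 + l + d) * k)%:R * pint (p *
    q).
Proof.
move=> hp hq lp; rewrite -(sum_mderiv_mderivM _ lp) pint_sum.
under eq_bigr => j _ do
  rewrite (pint_mderiv j (homogM (homog_mderiv j hp) hq)) mulrA.
transitivity ((k.-1 + l + d)%:R * pint ((\sum_j Xv j * mderiv j p) * q)).
  by rewrite mulr_suml pint_sum mulr_sumr.
by rewrite (euler_homog hp) (mulrnAl p) pintMn natrM -mulrA
  [in RHS](mulr_natl _ k).
Qed.

(** The left side of [pint_grad] is symmetric in p and q, the factor on the right is not: k (k + l -
    1 + d) and l (k + l - 1 + d) multiply the same integral, and differ when k != l and d > 0. *)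
Lemma pint_harmonic_orthogonal k l p q : (0 < d)%N -> p \is homog k ->
  q \is homog l -> laplacian p = 0 -> laplacian q = 0 -> k != l ->
  pint (p * q) = 0.
Proof.
move=> d0 hp hq lp lq kl.
have := pint_grad hp hq lp.
under eq_bigr do rewrite mulrC.
rewrite (pint_grad hq hp lq) (mulrC q) => /eqP; rewrite -subr_eq0 -mulrBl.
rewrite mulf_eq0 => /orP[|/eqP//]; rewrite subr_eq0 eqr_nat => /eqP E.
exfalso; move/eqP: kl; apply.
case: k l {hp hq} E => [|k] [|l] //=.
- by rewrite muln0 => /eqP; rewrite muln_eq0 !addn_eq0 orbF -(negbK (d ==
    _)) -lt0n d0 !andbF.
- by rewrite muln0 => /esym/eqP; rewrite muln_eq0 !addn_eq0 orbF -(negbK (d ==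
    _)) -lt0n d0 !andbF.
rewrite addnS addnS (addnC k l) => /eqP.
by rewrite eqn_pmul2l// => /eqP.
Qed.

End sphere_polynomials.

(** * Polynomial functions and expansions in spherical harmonics *)

(** The discriminant argument, shared by integrals and by finite sums of coefficients. A = 0 is
    allowed: a linear function of t that is nowhere negative is constant. *)
Lemma cauchy_schwarz_of_quadratic {R : realType} (A B C : R) : 0 <= A ->
  (forall t, 0 <= A * t ^+ 2 + 2 * B * t + C) -> B ^+ 2 <= A * C.
Proof.
rewrite le_eqVlt => /predU1P[<-|A0] H.
  rewrite mul0r; have [->|B0] := eqVneq B 0; first by rewrite expr0n.
  have := H (- (C + 1) / (2 * B)).
  by rewrite mul0r add0r mulrC divfK ?mulf_neq0// => ?; lra.
have := H (- B / A); rewrite -(ler_pM2l A0) mulr0.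
rewrite (_ : A * (A * _ ^+ 2 + _ + _) = A * C - B ^+ 2) ?subr_ge0//.
by field; rewrite gt_eqF.
Qed.

Section polyfun.
Import -(notations) mpoly.
Context {R : realType} {d : nat}.
Local Notation S := (sphere d : set 'rV[R]_d.+1).
Local Notation poly := (mpoly d.+1 R).
Implicit Types f g : 'rV[R]_d.+1 -> R.

(** Spherical polynomials of degree at most [n]: agreement is asked on the sphere only, and [msize]
    is the degree plus one. *)
Definition polyfun n f : Prop :=
  exists2 q : poly, (msize q <= n.+1)%N & forall x, S x -> f x = peval q x.

Lemma eq_polyfun n f g : (forall x, S x -> f x = g x) -> polyfun n f ->
  polyfun n g.
Proof. by move=> fg [q qn fq]; exists q => // x Sx; rewrite -fg// fq. Qed.

Lemma polyfun_leq m n f : (m <= n)%N -> polyfun m f -> polyfun n f.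
Proof. by move=> mn [q qm fq]; exists q => //; exact: leq_trans qm _. Qed.

Lemma polyfun_cst n c : polyfun n (fun=> c).
Proof.
exists (mpolyC _ c); last by move=> x _; rewrite pevalC.
by rewrite msizeC; case: eqP.
Qed.

Lemma polyfun_coord i : polyfun 1 (fun x => x ord0 i).
Proof.
exists (mpolyX R (mnm1 i)); last by move=> x _; rewrite pevalX.
by rewrite msizeX mdeg1.
Qed.

Lemma polyfunD n f g : polyfun n f -> polyfun n g ->
  polyfun n (fun x => f x + g x).
Proof.
move=> [p pn fp] [q qn gq]; exists (p + q).
  by apply: leq_trans (msizeD_le _ _) _; rewrite geq_max pn.
by move=> x Sx; rewrite pevalD fp// gq.
Qed.

Lemma polyfunM m n f g : polyfun m f -> polyfun n g ->
  polyfun (m + n) (fun x => f x * g x).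
Proof.
move=> [p pm fp] [q qn gq]; exists (p * q); last first.
  by move=> x Sx; rewrite pevalM fp// gq.
have [->|p0] := eqVneq p 0; first by rewrite mul0r msize0.
have [->|q0] := eqVneq q 0; first by rewrite mulr0 msize0.
rewrite msizeM//; have := leq_add pm qn; rewrite addSn addnS.
by case: (msize p + msize q)%N.
Qed.

Lemma polyfunZ n c f : polyfun n f -> polyfun n (fun x => c * f x).
Proof. by move=> pf; rewrite -[n]add0n; apply: polyfunM => //; exact:
  polyfun_cst. Qed.

Lemma polyfun_sum (I : eqType) (s : seq I) n (F : I -> 'rV[R]_d.+1 -> R) :
  (forall i, i \in s -> polyfun n (F i)) -> polyfun n (fun x => \sum_(i <- s) F
    i x).
Proof.
elim: s => [|i s IHs] PF.
  by apply: eq_polyfun (polyfun_cst n 0) => x _; rewrite big_nil.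
apply: (@eq_polyfun _ (fun x => F i x + \sum_(j <- s) F j x)).
  by move=> x _; rewrite big_cons.
apply: polyfunD; first by apply: PF; exact: mem_head.
by apply: IHs => j js; apply: PF; rewrite in_cons js orbT.
Qed.

Lemma polyfunX n k f : polyfun n f -> polyfun (n * k) (fun x => f x ^+ k).
Proof.
move=> pf; elim: k => [|k IHk]; first by rewrite muln0; exact: polyfun_cst.
rewrite mulnS; apply: eq_polyfun (polyfunM pf IHk) => x _.
by rewrite exprS.
Qed.

Lemma polyfun_prod (I : Type) (s : seq I) (e : I -> nat)
    (F : I -> 'rV[R]_d.+1 -> R) :
  (forall i, polyfun (e i) (F i)) ->
  polyfun (\sum_(i <- s) e i) (fun x => \prod_(i <- s) F i x).
Proof.
move=> PF; elim: s => [|i s IHs].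
  by apply: eq_polyfun (polyfun_cst _ 1) => x _; rewrite big_nil.
rewrite big_cons; apply: eq_polyfun (polyfunM (PF i) IHs) => x _.
by rewrite big_cons.
Qed.

Lemma polyfun_rot (i j : 'I_d.+1) c s n f : i != j -> c ^+ 2 + s ^+ 2 = 1 ->
  polyfun n f -> polyfun n (fun x => f (plane_rot i j c s x)).
Proof.
move=> ij cs [q qn fq].
have rotP k : polyfun 1 (fun x => plane_rot i j c s x ord0 k).
  apply: (@eq_polyfun _ (fun x => rot_coord i j c s (x ord0) k)).
    by move=> x _; rewrite plane_rotE.
  have px a k' : polyfun 1 (fun x => a * x ord0 k').
    by apply: polyfunZ; exact: polyfun_coord.
  rewrite /rot_coord; case: (k == i); last first.
    case: (k == j); last exact: polyfun_coord.
    by apply: polyfunD.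
  apply: eq_polyfun (polyfunD (px c i) (px (- s) j)) => x _.
  by rewrite mulNr.
apply: (@eq_polyfun _ (fun x => \sum_(m <- msupp q)
    mcoeff m q * \prod_k plane_rot i j c s x ord0 k ^+ m k)).
  by move=> x Sx; rewrite fq//; exact/(sphere_rot _ ij cs).
apply: polyfun_sum => m mq; apply: polyfunZ.
apply: (@polyfun_leq (\sum_k (1 * m k)%N)).
  rewrite (eq_bigr (fun k => m k)); last by move=> k _; rewrite mul1n.
  by rewrite -mdegE -ltnS; apply: leq_trans qn; exact: msize_mdeg_lt.
by apply: polyfun_prod => k; exact: polyfunX.
Qed.

Lemma polyfun_bdmeas n f : polyfun n f -> bdmeas f.
Proof.
move=> [q _ fq]; apply: (eq_bdmeas (f := peval q)); last exact: bdmeas_peval.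
by move=> x Sx; rewrite fq.
Qed.

Lemma polyfun_dotrow y : polyfun 1 (fun x => dotrow x y).
Proof.
apply: polyfun_sum => i _.
by apply: eq_polyfun (polyfunZ (y ord0 i) (polyfun_coord i)) => x _;
  rewrite mulrC.
Qed.

Lemma polyfun_peak y D : polyfun D (peak y D).
Proof.
rewrite -[D in polyfun D]mul1n; apply: polyfunX; apply: polyfunZ.
by apply: polyfunD; [exact: polyfun_cst|exact: polyfun_dotrow].
Qed.

End polyfun.

Section L2_inner_product.
Context {R : realType} {d : nat}.
Local Notation S := (sphere d : set 'rV[R]_d.+1).
Implicit Types f g : 'rV[R]_d.+1 -> R.

Lemma L2dotC f g : L2dot f g = L2dot g f.
Proof. by apply: eq_sphere_integral => x _; rewrite mulrC. Qed.

Lemma eq_L2dot f f' g g' : (forall x, S x -> f x = f' x) ->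
  (forall x, S x -> g x = g' x) -> L2dot f g = L2dot f' g'.
Proof. by move=> ff gg; apply: eq_sphere_integral => x Sx; rewrite ff// gg. Qed.

Lemma L2dot_ge0 f : 0 <= L2dot f f.
Proof. by apply: sphere_integral_ge0 => x _; rewrite -expr2 sqr_ge0. Qed.

Lemma L2dotBl f g h : bdmeas f -> bdmeas g -> bdmeas h ->
  L2dot (fun x => f x - g x) h = L2dot f h - L2dot g h.
Proof.
move=> bf bg bh; rewrite /L2dot -sphere_integralB; try exact: bdmeasM.
by apply: eq_sphere_integral => x _; rewrite mulrBl.
Qed.

Lemma L2dotBr f g h : bdmeas f -> bdmeas g -> bdmeas h ->
  L2dot h (fun x => f x - g x) = L2dot h f - L2dot h g.
Proof. by move=> bf bg bh; rewrite !(L2dotC h) L2dotBl. Qed.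

Lemma L2dotZl a f h : bdmeas f -> bdmeas h ->
  L2dot (fun x => a * f x) h = a * L2dot f h.
Proof.
move=> bf bh; rewrite /L2dot -sphere_integralZ; last exact: bdmeasM.
by apply: eq_sphere_integral => x _; rewrite mulrA.
Qed.

Lemma L2dot_suml (I : Type) (s : seq I) (P : pred I)
    (F : I -> 'rV[R]_d.+1 -> R) h :
  (forall i, bdmeas (F i)) -> bdmeas h ->
  L2dot (fun x => \sum_(i <- s | P i) F i x) h =
    \sum_(i <- s | P i) L2dot (F i) h.
Proof.
move=> bF bh; rewrite /L2dot -sphere_integral_sum; last by move=> i; exact:
  bdmeasM.
by apply: eq_sphere_integral => x _; rewrite mulr_suml.
Qed.

Lemma L2dot_sqB f g : bdmeas f -> bdmeas g ->
  L2dot (fun x => f x - g x) (fun x => f x - g x) =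
  L2dot f f - 2 * L2dot f g + L2dot g g.
Proof.
move=> bf bg; have bfg := bdmeasB bf bg.
by rewrite L2dotBl// !L2dotBr// (L2dotC g f); ring.
Qed.

Lemma L2dot_CauchySchwarz f g : bdmeas f -> bdmeas g ->
  L2dot f g ^+ 2 <= L2dot f f * L2dot g g.
Proof.
move=> bf bg; apply: cauchy_schwarz_of_quadratic; first exact: L2dot_ge0.
move=> t; have := L2dot_ge0 (fun x => - t * f x - g x).
have bt := bdmeasZ (- t) bf.
rewrite L2dot_sqB// !(L2dotZl _ bf)// (L2dotC f (fun x => - t * f x)) L2dotZl//.
by congr (0 <= _); ring.
Qed.

Lemma L2norm_ge0 f : 0 <= L2norm f.
Proof. exact: sqrtr_ge0. Qed.

Lemma sqr_L2norm f : L2norm f ^+ 2 = L2dot f f.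
Proof. by rewrite sqr_sqrtr// L2dot_ge0. Qed.

Lemma L2dot_le_norm f g : bdmeas f -> bdmeas g ->
  `|L2dot f g| <= L2norm f * L2norm g.
Proof.
move=> bf bg; rewrite -(@ler_pXn2r _ 2)// ?nnegrE ?mulr_ge0 ?L2norm_ge0//.
by rewrite real_normK ?num_real// exprMn !sqr_L2norm L2dot_CauchySchwarz.
Qed.

End L2_inner_product.

Section rotation_invariant_functions.
Context {R : realType} {d : nat}.
Local Notation S := (sphere d : set 'rV[R]_d.+1).

(* Successive plane rotations move any point of the sphere to the first pole. *)
Lemma rotation_le_constant (F : 'rV[R]_d.+1 -> R) : (0 < d)%N ->
  (forall (i j : 'I_d.+1) c s x, i != j -> 1 + c != 0 -> c ^+ 2 + s ^+ 2 = 1 ->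
    S x -> F (plane_rot i j c s x) <= F x) ->
  forall x y, S x -> S y -> F x = F y.
Proof.
move=> d0 Fle.
(* Equality comes from the inequality for the inverse rotation. *)
have Frot (i j : 'I_d.+1) c s x : i != j -> 1 + c != 0 ->
    c ^+ 2 + s ^+ 2 = 1 -> S x -> F (plane_rot i j c s x) = F x.
  move=> ij c0 cs Sx; apply/eqP; rewrite eq_le Fle//=.
  rewrite -{1}(plane_rotK ij cs x); apply: Fle => //; first by rewrite sqrrN.
  exact/(sphere_rot _ ij cs).
pose e0 : 'rV[R]_d.+1 := \row_i (i == ord0)%:R.
suff H m : forall x, S x -> (forall i : 'I_d.+1, (m < i)%N -> x ord0 i = 0) ->
    F x = F e0.
  have Hd x : S x -> F x = F e0.
    move=> Sx; apply: (H d) => // i di.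
    by have := ltn_ord i; rewrite ltnS leqNgt di.
  by move=> x y Sx Sy; rewrite !Hd.
elim: m => [|m IHm] x Sx x0.
  have xi (i : 'I_d.+1) : i != ord0 -> x ord0 i = 0.
    by move=> i0; apply: x0; rewrite lt0n.
  have : x ord0 ord0 ^+ 2 = 1.
    move: (Sx); rewrite /sphere/= (bigD1 ord0)//= big1 ?addr0// => i i0.
    by rewrite xi// expr0n.
  move=> /eqP; rewrite sqrf_eq1 => /orP[]/eqP x00.
    congr F; apply/rowP => i; rewrite mxE.
    by have [->|i0] := eqVneq i ord0; [rewrite x00|rewrite xi].
  (* Here x is the opposite pole. A half turn has c = -1, which is excluded; two quarter turns
     do. *)
  pose i1 : 'I_d.+1 := inord 1.
  have i10 : ord0 != i1 by rewrite -val_eqE /= inordK.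
  have cs : 0 ^+ 2 + 1 ^+ 2 = 1 :> R by rewrite expr0n expr1n add0r.
  have c1 : 1 + 0 != 0 :> R by rewrite addr0 oner_neq0.
  rewrite -(Frot _ _ _ _ x i10 c1 cs Sx).
  rewrite -(Frot _ _ _ _ _ i10 c1 cs (proj2 (sphere_rot x i10 cs) Sx)).
  congr F; apply/rowP => i; rewrite !plane_rotE /rot_coord !plane_rotE
    /rot_coord.
  rewrite eqxx mxE !mul0r !mul1r !sub0r !addr0 [i1 ==
    ord0]eq_sym (negbTE i10) eqxx.
  have [_|i0] := eqVneq i ord0; first by rewrite x00 opprK.
  have [_|ii] := eqVneq i i1; first by rewrite (xi i1) ?oppr0// eq_sym.
  by rewrite xi.
have [dm|md] := leqP d m.
  apply: IHm => // i mi; apply: x0.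
  by have := leq_trans (leq_ltn_trans dm mi) (ltn_ord i : (i <= d)%N);
    rewrite ltnn.
pose i : 'I_d.+1 := inord m.+1.
have vi : i = m.+1 :> nat by rewrite inordK.
have i0 : ord0 != i by rewrite -val_eqE /= vi.
pose a := x ord0 ord0; pose b := x ord0 i.
have [ab0|ab0] := eqVneq (a ^+ 2 + b ^+ 2) 0.
  apply: IHm => // j mj; case: (eqVneq j i) => [->|ji].
    move/eqP: ab0; rewrite paddr_eq0 ?sqr_ge0// => /andP[_].
    by rewrite sqrf_eq0 => /eqP.
  by apply: x0; rewrite ltn_neqAle mj andbT eq_sym -vi.
have ab1 : 0 < a ^+ 2 + b ^+ 2 by rewrite lt_def ab0 addr_ge0// sqr_ge0.
pose r := Num.sqrt (a ^+ 2 + b ^+ 2).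
have r0 : 0 < r by rewrite sqrtr_gt0.
have r2 : r ^+ 2 = a ^+ 2 + b ^+ 2 by rewrite sqr_sqrtr// ltW.
(* The sign makes the cosine nonnegative, hence 1 + c nonzero. Coordinate 0 becomes sg r, possibly
   negative; the base case accepts both poles. *)
pose sg : R := if 0 <= a then 1 else -1.
have sg2 : sg ^+ 2 = 1 by rewrite /sg; case: ifP => _; rewrite ?sqrrN expr1n.
pose c := sg * a / r; pose s := - (sg * b / r).
have cs : c ^+ 2 + s ^+ 2 = 1.
  by rewrite sqrrN !expr_div_n !exprMn sg2 !mul1r -mulrDl -r2 divff//
    expf_neq0// gt_eqF.
have c0 : 0 <= c.
  rewrite divr_ge0 ?(ltW r0)// /sg; case: ifPn; first by rewrite mul1r.
  by rewrite -ltNge mulN1r oppr_ge0 => /ltW.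
have c1 : 1 + c != 0 by rewrite gt_eqF// ltr_pwDl.
rewrite -(Frot _ _ _ _ x i0 c1 cs Sx); apply: IHm.
  exact/(sphere_rot _ i0 cs).
move=> j mj; rewrite plane_rotE /rot_coord.
have [j0|_] := eqVneq j ord0; first by move: mj; rewrite j0.
have [_|ji] := eqVneq j i; first by rewrite -/a -/b /s /c; ring.
by apply: x0; rewrite ltn_neqAle mj andbT eq_sym -vi.
Qed.

End rotation_invariant_functions.

Section harmonic_basis_theory.
Import -(notations) mpoly.
Context {R : realType} {d : nat}.
Local Notation S := (sphere d : set 'rV[R]_d.+1).
Local Notation L := (@sphere_integral R d).
Local Notation poly := (mpoly d.+1 R).
Local Notation homog k := (ishomog1 k (@mdeg d.+1)).
Implicit Types f g : 'rV[R]_d.+1 -> R.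

Lemma spherical_harmonic_polyfun l f : spherical_harmonic l f -> polyfun l f.
Proof.
move=> [p [/dhomogP hp _ fp]]; exists p => //.
rewrite msizeE big_seq; elim/big_ind: _ => // [m m' ml m'l|m mp].
  by rewrite geq_max ml.
by rewrite ltnS (hp m mp).
Qed.

Lemma spherical_harmonic0 l : spherical_harmonic l (fun=> 0 : R) (d := d).
Proof.
exists 0; split; first exact: dhomog0.
  by rewrite big1// => i _; rewrite !mderiv0.
by move=> x _; rewrite meval0.
Qed.

Lemma spherical_harmonicD l f g : spherical_harmonic l f ->
  spherical_harmonic l g -> spherical_harmonic l (fun x => f x + g x).
Proof.
move=> [p [hp lp fp]] [q [hq lq gq]]; exists (p + q); split.
- exact: rpredD.
- have := laplacianD p q; rewrite /laplacian lp lq addr0; exact.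
- by move=> x Sx; rewrite mevalD fp// gq.
Qed.

Lemma spherical_harmonic_orthogonal k l f g : (0 < d)%N ->
  spherical_harmonic k f -> spherical_harmonic l g -> k != l -> L2dot f g = 0.
Proof.
move=> d0 [p [hp lp fp]] [q [hq lq gq]] kl.
rewrite -(pint_harmonic_orthogonal d0 hp hq lp lq kl).
by apply: eq_sphere_integral => x Sx; rewrite pevalM fp// gq.
Qed.

Definition harmonic_sum n f : Prop :=
  exists2 g : nat -> 'rV[R]_d.+1 -> R, (forall l, spherical_harmonic l (g l)) &
    forall x, S x -> f x = \sum_(l < n.+1) g l x.

Lemma eq_harmonic_sum n f g : (forall x, S x -> f x = g x) ->
  harmonic_sum n f -> harmonic_sum n g.
Proof. by move=> fg [h hh fh]; exists h => // x Sx; rewrite -fg// fh. Qed.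

Lemma harmonic_sumD n f g : harmonic_sum n f -> harmonic_sum n g ->
  harmonic_sum n (fun x => f x + g x).
Proof.
move=> [F hF fF] [G hG gG]; exists (fun l x => F l x + G l x).
  by move=> l; exact: spherical_harmonicD.
by move=> x Sx; rewrite big_split/= fF// gG.
Qed.

Lemma harmonic_sum_leq m n f : (m <= n)%N -> harmonic_sum m f ->
  harmonic_sum n f.
Proof.
move=> mn [g hg fg]; exists (fun l => if (l < m.+1)%N then g l else fun=> 0).
  by move=> l; case: ifP => _ //; exact: spherical_harmonic0.
move=> x Sx; rewrite fg//.
rewrite (big_ord_widen n.+1 (fun l => g l x))// big_mkcond.
by apply: eq_bigr => l _; case: ifP.
Qed.

Lemma spherical_harmonic_sum l f : spherical_harmonic l f -> harmonic_sum l f.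
Proof.
move=> hf; exists (fun l' => if l' == l then f else fun=> 0).
  by move=> l'; case: eqP => [->//|_]; exact: spherical_harmonic0.
move=> x Sx; rewrite big_ord_recr/= eqxx big1 ?add0r// => i _.
by rewrite ltn_eqF.
Qed.

(** On the sphere [harmonic_split] reads q = h + r, with [r] of degree two less. *)
Lemma homog_harmonic_sum k (q : poly) : q \is homog k ->
  harmonic_sum k (peval q).
Proof.
elim/ltn_ind: k q => k IHk q hq.
have [h [r [hh lh hr qE r0]]] := harmonic_split (ltn0Sn d) hq.
apply: (@eq_harmonic_sum _ (fun x => peval h x + peval r x)).
  by move=> x Sx; rewrite qE pevalD pevalM peval_sqnorm_poly// mul1r.
apply: harmonic_sumD; first by apply: spherical_harmonic_sum; exists h.
have [/r0->|k2] := ltnP k 2.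
  apply: (@eq_harmonic_sum _ (fun=> 0)); first by move=> x _; rewrite peval0.
  exact/spherical_harmonic_sum/spherical_harmonic0.
apply: (@harmonic_sum_leq (k - 2)); first exact: leq_subr.
by apply: IHk => //; rewrite ltn_subrL (leq_trans _ k2).
Qed.

Lemma polyfun_harmonic_sum n f : polyfun n f -> harmonic_sum n f.
Proof.
move=> [q qn fq]; apply: (@eq_harmonic_sum _ (peval q)).
  by move=> x Sx; rewrite fq.
have : forall s : seq (multinom d.+1), (forall m, m \in s -> mdeg m <= n)%N ->
    harmonic_sum n (peval (\sum_(m <- s) mcoeff m q *: mpolyX R m)).
  elim=> [|m s IHs] Hs.
    apply: (@eq_harmonic_sum _ (fun=> 0)).
      by move=> x _; rewrite big_nil peval0.
    apply: (harmonic_sum_leq (leq0n n)).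
    exact/spherical_harmonic_sum/spherical_harmonic0.
  rewrite big_cons; apply: (@eq_harmonic_sum _ (fun x =>
    peval (mcoeff m q *: mpolyX R m) x +
    peval (\sum_(m <- s) mcoeff m q *: mpolyX R m) x)).
    by move=> x _; rewrite pevalD.
  apply: harmonic_sumD.
    apply: (harmonic_sum_leq (Hs m (mem_head _ _))).
    by apply/homog_harmonic_sum/dhomogZ; rewrite dhomogX/=.
  by apply: IHs => m' m's; apply: Hs; rewrite in_cons m's orbT.
move=> /(_ (msupp q)); rewrite -mpolyE; apply => m mq.
by rewrite -ltnS; apply: leq_trans qn; exact: msize_mdeg_lt.
Qed.

End harmonic_basis_theory.

(** * Expansions in the basis, reproducing kernel and addition theorem *)

Section harmonic_expansion.
Import -(notations) mpoly.
Context {R : realType} {d : nat}.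
Hypothesis d_gt0 : (0 < d)%N.
Local Notation S := (sphere d : set 'rV[R]_d.+1).
Local Notation L := (@sphere_integral R d).
Local Notation idx l := 'I_(dim_harmonic d l).
Implicit Types f g : 'rV[R]_d.+1 -> R.

(** The bound is exclusive: degree at most n corresponds to [ysum n.+1]. *)
Definition ysum N (F : forall l, idx l -> R) : R :=
  \sum_(l < N) \sum_(k < dim_harmonic d l) F l k.

Lemma eq_ysum N F G :
  (forall (l : nat) k, (l < N)%N -> F l k = G l k) -> ysum N F = ysum N G.
Proof. by move=> FG; apply: eq_bigr => l _; apply: eq_bigr => k _; exact:
  FG. Qed.

Lemma ler_ysum N F G :
  (forall (l : nat) k, (l < N)%N -> F l k <= G l k) -> ysum N F <= ysum N G.
Proof. by move=> FG; apply: ler_sum => l _; apply: ler_sum => k _; exact: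
  FG. Qed.

Lemma ysum_ge0 N F : (forall l k, 0 <= F l k) -> 0 <= ysum N F.
Proof. by move=> F0; do 2 (apply: sumr_ge0 => ? _). Qed.

Lemma ysumD N F G : ysum N (fun l k => F l k + G l k) = ysum N F + ysum N G.
Proof. by rewrite -big_split; apply: eq_bigr => l _; rewrite big_split. Qed.

Lemma ysumZ N c F : ysum N (fun l k => c * F l k) = c * ysum N F.
Proof. by rewrite mulr_sumr; apply: eq_bigr => l _; rewrite mulr_sumr. Qed.

Lemma ysumB N F G : ysum N (fun l k => F l k - G l k) = ysum N F - ysum N G.
Proof. by rewrite -sumrB; apply: eq_bigr => l _; rewrite sumrB. Qed.

Lemma ysumS N F : ysum N.+1 F = ysum N F + \sum_(k < dim_harmonic d N) F N k.
Proof. by rewrite /ysum big_ord_recr. Qed.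

Lemma ysum_trunc m n F : (m <= n)%N ->
  ysum m F = ysum n (fun l k => if (l < m)%N then F l k else 0).
Proof.
move=> mn; rewrite /ysum (big_ord_widen n (fun l =>
  \sum_(k < dim_harmonic d l) F l k))// big_mkcond.
by apply: eq_bigr => l _; case: ifP => // _; rewrite big1.
Qed.

Lemma ysum_CauchySchwarz N F G : ysum N (fun l k => F l k * G l k) ^+ 2 <=
  ysum N (fun l k => F l k ^+ 2) * ysum N (fun l k => G l k ^+ 2).
Proof.
apply: cauchy_schwarz_of_quadratic => [|t].
  by apply: ysum_ge0 => *; exact: sqr_ge0.
rewrite mulrC -mulrA (mulrC _ t) mulrA -!ysumZ -!ysumD; apply: ysum_ge0 => l k.
rewrite (_ : _ + _ = (t * F l k + G l k) ^+ 2) ?sqr_ge0//; ring.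
Qed.

Variable Y : forall l : nat, idx l -> 'rV[R]_d.+1 -> R.
Hypothesis hY : harmonic_basis Y.

Lemma basis_harmonic l (k : idx l) : spherical_harmonic l (Y k).
Proof. by have [] := hY l. Qed.

Lemma basis_polyfun l (k : idx l) : polyfun l (Y k).
Proof. exact/spherical_harmonic_polyfun/basis_harmonic. Qed.

Lemma basis_bdmeas l (k : idx l) : bdmeas (Y k).
Proof. exact/polyfun_bdmeas/basis_polyfun. Qed.

Lemma basis_orthogonal l l' (k : idx l) (k' : idx l') : l != l' ->
  L2dot (Y k) (Y k') = 0.
Proof.
by apply: spherical_harmonic_orthogonal => //; exact: basis_harmonic.
Qed.

Lemma basis_orthonormal l (k k' : idx l) : L2dot (Y k) (Y k') = (k == k')%:R.
Proof. by have [] := hY l. Qed.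

Definition ycomb N (b : forall l, idx l -> R)
    (x : 'rV[R]_d.+1) : R :=
  ysum N (fun l k => b l k * Y k x).

Lemma ycomb_bdmeas N b : bdmeas (ycomb N b).
Proof.
apply: bdmeas_sum => l; apply: bdmeas_sum => k.
exact/bdmeasZ/basis_bdmeas.
Qed.

Lemma ycomb_polyfun N b : polyfun N.-1 (ycomb N b).
Proof.
apply: polyfun_sum => l _; apply: polyfun_sum => k _; apply: polyfunZ.
apply: (@polyfun_leq _ _ l); last exact: basis_polyfun.
by case: N l k => [[]//|N] l _ /=; rewrite -ltnS.
Qed.

Lemma L2dot_ycomb N b h : bdmeas h ->
  L2dot (ycomb N b) h = ysum N (fun l k => b l k * L2dot (Y k) h).
Proof.
move=> bh; have bY l (k : idx l) : bdmeas (fun x => b l k * Y k x).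
  exact/bdmeasZ/basis_bdmeas.
rewrite /ycomb /ysum L2dot_suml//; last by move=> l; exact: bdmeas_sum.
apply: eq_bigr => l _; rewrite L2dot_suml//.
by apply: eq_bigr => k _; rewrite L2dotZl//; exact: basis_bdmeas.
Qed.

Lemma ycomb_coef N b (l : nat) (k : idx l) : (l < N)%N ->
  L2dot (ycomb N b) (Y k) = b l k.
Proof.
move=> lN; rewrite L2dot_ycomb; last exact: basis_bdmeas.
rewrite /ysum (bigD1 (Ordinal lN))//= [X in _ + X]big1 ?addr0; last first.
  move=> l' l'l; rewrite big1// => k' _; rewrite basis_orthogonal ?mulr0//.
rewrite (bigD1 k)//= big1 ?addr0; first by rewrite basis_orthonormal eqxx mulr1.
by move=> k' k'k; rewrite basis_orthonormal (negbTE k'k) mulr0.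
Qed.

Lemma ycomb_coef0 N b (l : nat) (k : idx l) : (N <= l)%N ->
  L2dot (ycomb N b) (Y k) = 0.
Proof.
move=> Nl; rewrite L2dot_ycomb; last exact: basis_bdmeas.
rewrite /ysum big1// => l' _; rewrite big1// => k' _.
rewrite basis_orthogonal ?mulr0//; apply: contraTneq Nl => <-.
by rewrite -ltnNge.
Qed.

Lemma L2dot_ycombE N b b' :
  L2dot (ycomb N b) (ycomb N b') = ysum N (fun l k => b l k * b' l k).
Proof.
rewrite L2dot_ycomb; last exact: ycomb_bdmeas.
by apply: eq_ysum => l k lN; rewrite L2dotC ycomb_coef.
Qed.

Definition ycoef f l (k : idx l) : R := L2dot f (Y k).

(** The decomposition into harmonics and the spanning property give some coefficients;
    orthonormality, within a degree by hypothesis and across degrees by [basis_orthogonal],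
    identifies them. *)
Lemma polyfun_expansion n f : polyfun n f ->
  forall x, S x -> f x = ycomb n.+1 (ycoef f) x.
Proof.
move=> pf; have [g hg fg] := polyfun_harmonic_sum pf.
have /all_sig[b bE] l : {b : idx l -> R |
    forall x, S x -> g l x = \sum_k b k * Y k x}.
  by apply: cid; have [_ _] := hY l; exact.
have fb x : S x -> f x = ycomb n.+1 b x.
  by move=> Sx; rewrite fg//; apply: eq_bigr => l _; exact: bE.
move=> x Sx; rewrite fb//; apply: eq_ysum => l k ln.
congr (_ * _); rewrite /ycoef -(@ycomb_coef n.+1 b l k ln).
by apply: eq_L2dot => // y Sy; rewrite fb.
Qed.

Lemma polyfun_coef0 n f (l : nat) (k : idx l) : polyfun n f -> (n < l)%N ->
  ycoef f k = 0 :> R.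
Proof.
move=> pf nl; rewrite /ycoef -(@ycomb_coef0 n.+1 (ycoef f) l k nl).
by apply: eq_L2dot => // x Sx; exact: polyfun_expansion.
Qed.

(** Pythagoras. The exact defect, not just its sign, is needed in [sobolev_L2_approximation]. *)
Lemma bessel N f : bdmeas f ->
  L2dot (fun x => f x - ycomb N (ycoef f) x) (fun x => f x - ycomb N (ycoef f)
    x) =
  L2dot f f - ysum N (fun l k => ycoef f k ^+ 2).
Proof.
move=> bf; rewrite L2dot_sqB//; last exact: ycomb_bdmeas.
rewrite L2dot_ycombE (L2dotC f) L2dot_ycomb//.
have -> : ysum N (fun l k => ycoef f k * L2dot (Y k) f) =
    ysum N (fun l k => ycoef f k ^+ 2).
  by apply: eq_ysum => l k _; rewrite (L2dotC _ f).
have -> : ysum N (fun l k => ycoef f k * ycoef f k) =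
    ysum N (fun l k => ycoef f k ^+ 2) by [].
by ring.
Qed.

Lemma bessel_le N f : bdmeas f ->
  ysum N (fun l k => ycoef f k ^+ 2) <= L2dot f f.
Proof. by move=> bf; rewrite -subr_ge0 -bessel// L2dot_ge0. Qed.

(** Diagonal of the reproducing kernel of the spherical polynomials of degree less than [N]. *)
Definition kern N (x : 'rV[R]_d.+1) : R := ysum N (fun l k => Y k x ^+ 2).

Lemma polyfun_pointwise n f x : polyfun n f -> S x ->
  f x ^+ 2 <= kern n.+1 x * L2dot f f.
Proof.
move=> pf Sx; have bf := polyfun_bdmeas pf.
rewrite (polyfun_expansion pf Sx); apply: le_trans (ysum_CauchySchwarz _ _ _) _.
rewrite mulrC; apply: ler_wpM2l.
  by apply: ysum_ge0 => *; exact: sqr_ge0.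
exact: bessel_le.
Qed.

(** Let g be the reproducing kernel at y, the image of x. Then g(y) and the squared norm of g both
    equal [kern] at y. The rotated g has the same norm and takes the value g(y) at x, so the
    pointwise bound at x gives kern(y)^2 <= kern(x) kern(y). *)
Lemma kern_rot_le n (i j : 'I_d.+1) c s x : i != j -> 1 + c != 0 ->
  c ^+ 2 + s ^+ 2 = 1 -> S x -> kern n.+1 (plane_rot i j c s x) <= kern n.+1 x.
Proof.
move=> ij c0 cs Sx; set y := plane_rot i j c s x.
have Sy : S y by exact/(sphere_rot _ ij cs).
have k0 : 0 <= kern n.+1 y by apply: ysum_ge0 => *; exact: sqr_ge0.
have k0' : 0 <= kern n.+1 x by apply: ysum_ge0 => *; exact: sqr_ge0.
pose g := ycomb n.+1 (fun l k => Y k y).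
have pg : polyfun n g by exact: (ycomb_polyfun n.+1).
have gg : L2dot g g = kern n.+1 y by rewrite L2dot_ycombE.
have gy : g y = kern n.+1 y by [].
have pgr := polyfun_rot ij cs pg.
have [q _ gq] := pg.
have E : L2dot (fun z => g (plane_rot i j c s z)) (fun z => g (plane_rot i j c
  s z))
    = L2dot g g.
  transitivity (L (fun z => peval (q * q) (plane_rot i j c s z))).
    apply: eq_sphere_integral => z Sz.
    by rewrite pevalM gq//; exact/(sphere_rot _ ij cs).
  rewrite (sphere_integral_rot ij c0 cs (f := peval (q * q))).
  - by apply: eq_sphere_integral => z Sz; rewrite pevalM gq.
  - exact: measurable_peval.
  - exact: bdmeas_peval.
  - exact: bdmeas_peval_rot.
have := polyfun_pointwise pgr Sx; rewrite E gg -/y gy.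
have [->//|kn0] := eqVneq (kern n.+1 y) 0.
by rewrite expr2 ler_pM2r// lt_def kn0.
Qed.

Lemma kern_const n x y : S x -> S y -> kern n x = kern n y.
Proof.
case: n => [|n] Sx Sy; first by rewrite /kern /ysum !big_ord0.
by apply: (rotation_le_constant d_gt0 _ Sx Sy) => *; exact: kern_rot_le.
Qed.

(** The sum is the difference of two consecutive kernels, hence constant on the sphere; integrating
    it gives the constant. *)
Lemma addition_theorem l x : S x ->
  (\sum_(k < dim_harmonic d l) Y k x ^+ 2) * L (fun=> 1) =
    (dim_harmonic d l)%:R.
Proof.
move=> Sx; rewrite -sphere_integral_cst.
transitivity (L (fun y => \sum_(k < dim_harmonic d l) Y k y ^+ 2)).
  apply: eq_sphere_integral => y Sy.
  have := kern_const l.+1 Sx Sy; have := kern_const l Sx Sy.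
  by rewrite /kern !ysumS => -> /addrI.
rewrite sphere_integral_sum; last by move=> k; exact/bdmeasX/basis_bdmeas.
rewrite (eq_bigr (fun=> 1)) ?sumr_const ?card_ord// => k _.
transitivity (L2dot (Y k) (Y k)); last by rewrite basis_orthonormal eqxx.
by apply: eq_sphere_integral => y _; rewrite expr2.
Qed.

End harmonic_expansion.

(** * Uniform convergence in Sobolev spaces *)

Section zeta_tails.
Context {R : realType}.

(** With y = 1 + x: x^(-eta) = y^(-eta) exp(eta ln(y / x)), where ln(y / x) >= 1 / y and exp u >= 1
    + u. *)
Lemma powR_telescope (eta x : R) : 0 < eta -> 0 < x ->
  (1 + x) `^ (- (1 + eta)) <= eta^-1 * (x `^ (- eta) - (1 + x) `^ (- eta)).
Proof.
move=> eta0 x0; set y := 1 + x.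
have y0 : 0 < y by rewrite addr_gt0.
have lnE : y^-1 <= ln y - ln x.
  rewrite -[leRHS]opprB lerNr -ln_div ?posrE//.
  have -> : x / y = 1 + (- y^-1).
    by move: y0; rewrite /y => y0; field; rewrite gt_eqF.
  apply: le_ln1Dx; rewrite ltrN2 invf_lt1 ?ltrDl//.
have -> : x `^ (- eta) = y `^ (- eta) * expR (eta * (ln y - ln x)).
  by rewrite /powR !gt_eqF// -expRD; congr expR; ring.
have -> : y `^ (- (1 + eta)) = y `^ (- eta) * y^-1.
  rewrite opprD addrC powRD ?powR_inv1 ?ltW//.
  by rewrite (gt_eqF y0) implybT.
rewrite -[X in _ - X]mulr1 -mulrBr mulrCA ler_wpM2l ?powR_ge0//.
rewrite ler_pdivlMl//; apply: le_trans (ler_wpM2l (ltW eta0) lnE) _.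
by rewrite lerBrDl expR_ge1Dx.
Qed.

(** The integral bound for the sum over l >= N. At N = 0 the term 1 of index 0 is split off. *)
Definition zeta_tail (eta : R) (N : nat) : R :=
  if N == 0%N then 1 + eta^-1 else eta^-1 * N%:R `^ (- eta).

Lemma zeta_tail_ge0 eta N : 0 < eta -> 0 <= zeta_tail eta N.
Proof.
move=> eta0; rewrite /zeta_tail; case: ifP => _.
  by rewrite addr_ge0// invr_ge0 ltW.
by rewrite mulr_ge0 ?powR_ge0// invr_ge0 ltW.
Qed.

Lemma zeta_tailP eta N M : 0 < eta ->
  \sum_(N <= l < M) (1 + l%:R) `^ (- (1 + eta)) <= zeta_tail eta N.
Proof.
move=> eta0.
have H N' : (0 < N')%N -> forall M, (N' <= M)%N ->
    \sum_(N' <= l < M) (1 + l%:R) `^ (- (1 + eta)) <=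
    eta^-1 * (N'%:R `^ (- eta) - M%:R `^ (- eta)).
  move=> N0; elim=> [|M' IHM]; first by rewrite leqNgt N0.
  rewrite leq_eqVlt => /predU1P[<-|NM]; first by rewrite big_geq// subrr mulr0.
  rewrite big_nat_recr//=; apply: le_trans (lerD (IHM NM) _) _.
    apply: powR_telescope => //; rewrite ltr0n; exact: leq_trans N0 NM.
  by rewrite -mulrDr -natr1 addrA subrK [M'%:R + 1]addrC.
have [MN|NM] := leqP M N; first by rewrite big_geq// zeta_tail_ge0.
have H1 N' : (0 < N')%N -> (N' <= M)%N ->
    \sum_(N' <= l < M) (1 + l%:R) `^ (- (1 + eta)) <= eta^-1 * N'%:R `^ (- eta).
  move=> N0 NM'; apply: le_trans (H N' N0 M NM') _.
  by rewrite ler_wpM2l ?invr_ge0 ?(ltW eta0)// gerBl powR_ge0.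
rewrite /zeta_tail; case: N NM => [|N] NM /=; last first.
  by apply: H1 => //; exact: ltnW.
rewrite big_ltn// addr0 powR1 lerD2l.
by apply: le_trans (H1 1%N _ _) _ => //; rewrite powR1 mulr1.
Qed.

Lemma zeta_tail_small eta e : 0 < eta -> 0 < e ->
  exists N0, forall N, (N0 <= N)%N -> zeta_tail eta N <= e.
Proof.
(* [B] solves eta^-1 B^(-eta) = e. *)
move=> eta0 e0; pose B := ((eta * e)^-1) `^ (eta^-1).
exists (Num.truncn B).+1 => N NB.
have N0 : (0 < N)%N by exact: leq_trans NB.
have BN : B <= N%:R.
  by apply: le_trans (_ : (Num.truncn B).+1%:R <= _);
    rewrite ?ler_nat// ltW// truncnS_gt.
rewrite /zeta_tail gtn_eqF// ler_pdivrMl// powRN.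
have ee : 0 < eta * e by rewrite mulr_gt0.
rewrite -[leRHS]invrK lef_pV2 ?posrE ?invr_gt0 ?powR_gt0 ?ltr0n//.
have -> : (eta * e)^-1 = B `^ eta.
  by rewrite /B -powRrM mulVf ?gt_eqF// powRr1// invr_ge0 ltW.
by rewrite ge0_ler_powR ?nnegrE ?powR_ge0 ?(ltW eta0).
Qed.

End zeta_tails.

Section dimension_bounds.

Lemma ffact_le_exp n m : (n ^_ m <= n ^ m)%N.
Proof.
rewrite ffact_prod -[leqRHS](_ : \prod_(i < m) n = _)%N.
  by apply: leq_prod => i _; exact: leq_subr.
by rewrite prod_nat_const card_ord.
Qed.

(** For l >= 1, Z(d, l) (d - 1)! = (2 l + d - 1) (l + d - 2) ... (l + 1): one factor at most 2 d (l
    + 1) and d - 2 factors at most d (l + 1). *)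
Lemma dim_harmonic_le d l : (2 <= d)%N ->
  (dim_harmonic d l <= 2 * d ^ (d - 1) * l.+1 ^ (d - 1))%N.
Proof.
move=> d2; case: (posnP l) => [->|l0].
  rewrite /dim_harmonic /= exp1n muln1.
  by rewrite muln_gt0/= expn_gt0 (leq_trans _ d2).
have E := dim_harmonicE d2 l0.
have fE : ((l + d - 2)`! = (l + d - 2) ^_ (d - 2) * l`!)%N.
  have lE : (l + d - 2 - (d - 2) = l)%N by rewrite -addnBA// addnK.
  have dl : (d - 2 <= l + d - 2)%N by rewrite -addnBA// leq_addl.
  by have := ffact_fact dl; rewrite lE => ->.
have f1 : (dim_harmonic d l * (d - 1)`! =
    (2 * l + d - 1) * (l + d - 2) ^_ (d - 2))%N.
  apply/eqP; rewrite -(eqn_pmul2r (fact_gt0 l)) -!mulnA -fE.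
  by rewrite E.
apply: (@leq_trans (dim_harmonic d l * (d - 1)`!)).
  by rewrite leq_pmulr// fact_gt0.
rewrite f1; have -> : (d - 1 = (d - 2).+1)%N by rewrite -subSn// subSS.
rewrite expnS (expnS l.+1) !mulnA.
rewrite (_ : 2 * d * d ^ (d - 2) * l.+1 = (2 * d * l.+1) * d ^ (d - 2))%N;
  last by rewrite mulnAC.
rewrite -mulnA -expnMn; apply: leq_mul.
  apply: (@leq_trans (2 * l + d)); first exact: leq_subr.
  rewrite mulnS; apply: (@leq_trans (2 * d + 2 * l)).
    by rewrite addnC leq_add2r leq_pmull.
  by rewrite leq_add2l -mulnA leq_mul2l/= leq_pmull// (leq_trans _ d2).
apply: leq_trans (ffact_le_exp _ _) _.
have : (l + d - 2 <= d * l.+1)%N.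
  apply: leq_trans (leq_subr _ _) _; rewrite mulnS addnC leq_add2l.
  by rewrite leq_pmull// (leq_trans _ d2).
by case: (d - 2)%N => [|e]; rewrite ?expn0 ?leq_exp2r.
Qed.

(** The truncated division might round to 0; its exactness excludes this. *)
Lemma dim_harmonic_gt0 d l : (2 <= d)%N -> (0 < dim_harmonic d l)%N.
Proof.
move=> d2; case: (posnP l) => [->//|l0].
have := dim_harmonicE d2 l0.
case: (dim_harmonic d l) => //; rewrite mul0n => /esym/eqP.
rewrite muln_eq0 (gtn_eqF (fact_gt0 _)) orbF => /eqP E.
have : (0 < 2 * l + d - 1)%N by rewrite subn_gt0; apply:
  leq_trans d2 (leq_addl _ _).
by rewrite E.
Qed.

End dimension_bounds.

Section sphere_continuity.
Context {R : realType} {d : nat}.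
Local Notation S := (sphere d : set 'rV[R]_d.+1).
Implicit Types f g : 'rV[R]_d.+1 -> R.

Lemma sqr_dist_sphere (x y : 'rV[R]_d.+1) : S x -> S y ->
  \sum_i (x ord0 i - y ord0 i) ^+ 2 = 2 * (1 - dotrow x y).
Proof.
move=> Sx Sy; transitivity (\sum_i (x ord0 i ^+ 2 + y ord0 i ^+ 2 +
    (-2) * (x ord0 i * y ord0 i))); first by apply: eq_bigr => i _; ring.
by rewrite !big_split/= -mulr_sumr Sx Sy -/(dotrow x y); ring.
Qed.

(** By [sqr_dist_sphere] the cap is |x - x0|^2 < 2 h, inside the sup-norm ball of radius r once h <=
    r^2 / 2. The bound h <= 1 is what [peak_integral_gt0] asks for. *)
Lemma within_continuous_cap f x0 e : {within S, continuous f} -> S x0 ->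
  0 < e -> exists h, [/\ 0 < h, h <= 1 &
    forall x, S x -> cap x0 h x -> `|f x0 - f x| < e].
Proof.
move=> cf Sx0 e0.
have /cvgrPdist_lt/(_ e e0) := (subspace_continuousP _ _).1 cf x0 Sx0.
rewrite near_withinE => /nbhs_ballP[r /= r0 Hr].
pose h := Num.min 1 (r ^+ 2 / 2).
have h0 : 0 < h by rewrite lt_min ltr01/= divr_gt0// exprn_gt0.
exists h; split => //; first by rewrite ge_min lexx.
move=> x Sx xC; apply: Hr => //; split=> // i j; rewrite ord1 /ball/=.
rewrite -(@ltr_pXn2r _ 2)// ?nnegrE ?(ltW r0)//.
rewrite real_normK ?num_real//.
apply: (@le_lt_trans _ _ (\sum_j (x0 ord0 j - x ord0 j) ^+ 2)).
  by rewrite (bigD1 j)//= lerDl; apply: sumr_ge0 => k _; exact: sqr_ge0.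
have -> : \sum_j (x0 ord0 j - x ord0 j) ^+ 2 = 2 * (1 - dotrow x x0).
  by rewrite -sqr_dist_sphere//; apply: eq_bigr => k _; rewrite -sqrrN opprB.
have : h <= r ^+ 2 / 2 by rewrite ge_min lexx orbT.
by move: xC; rewrite /cap/=; lra.
Qed.

Lemma within_continuousB f g : {within S, continuous f} ->
  {within S, continuous g} -> {within S, continuous (fun x => f x - g x)}.
Proof.
move=> /subspace_continuousP cf /subspace_continuousP cg.
by apply/subspace_continuousP => x Sx; apply: cvgB; [exact: cf|exact: cg].
Qed.

Lemma within_continuousM f g : {within S, continuous f} ->
  {within S, continuous g} -> {within S, continuous (fun x => f x * g x)}.
Proof.
move=> /subspace_continuousP cf /subspace_continuousP cg.
by apply/subspace_continuousP => x Sx; apply: cvgM; [exact: cf|exact: cg].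
Qed.

Lemma compact_sphere : compact S.
Proof.
apply: bounded_closed_compact.
  exists 1; split; first exact: num_real.
  move=> M M1 x Sx; rewrite /= [leLHS]/Num.norm/= mx_normrE.
  apply/bigmax_leP; split => /=; first by apply: ltW; exact: lt_trans M1.
  move=> [i j] _ /=; rewrite ord1; apply: le_trans (ltW M1).
  exact: norm_coord_sphere.
have -> : S = peval sqnorm_poly @^-1` [set 1].
  apply/seteqP; split => x; first exact: peval_sqnorm_poly.
  rewrite /= /sphere/= => <-; rewrite peval_sum; apply: eq_bigr => i _.
  by rewrite pevalM pevalX expr2.
apply: (continuous_closedP _).1; first exact: continuous_peval.
exact: closed_eq.
Qed.

Lemma within_continuous_bounded f : {within S, continuous f} ->
  exists M, forall x, S x -> `|f x| <= M.
Proof.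
move=> cf; have /compact_bounded[M [_ fM]] := continuous_compact cf
  compact_sphere.
by exists (M + 1) => x Sx; apply: (fM (M + 1)); [rewrite ltrDl|exists x].
Qed.

End sphere_continuity.

(** * Partial sums: orthogonality, uniform and L^2 approximation *)

Section sobolev_approximation.
Context {R : realType} {d : nat}.
Hypothesis d_ge2 : (2 <= d)%N.
Local Notation S := (sphere d : set 'rV[R]_d.+1).
Local Notation L := (@sphere_integral R d).
Local Notation idx l := 'I_(dim_harmonic d l).
Local Notation area := (L (fun=> 1)).
Implicit Types f g : 'rV[R]_d.+1 -> R.

Let d_gt0 : (0 < d)%N. Proof. exact: ltnW. Qed.

Lemma sphere_nonempty : S (\row_i (i == ord0)%:R).
Proof.
rewrite /sphere/= (bigD1 ord0)//= mxE eqxx expr1n big1 ?addr0// => i i0.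
by rewrite mxE (negbTE i0) expr0n.
Qed.

Lemma area_gt0 : 0 < area.
Proof.
apply: lt_le_trans (cap_integral_gt0 sphere_nonempty ltr01) _.
apply: le_sphere_integral; [|exact: bdmeas_cst|].
  by apply: bdmeas_indic; exact: measurable_cap.
by move=> x _; rewrite indicE; case: (_ \in _).
Qed.

Variable Y : forall l : nat, idx l -> 'rV[R]_d.+1 -> R.
Hypothesis hY : harmonic_basis Y.

(** Degrees less than [N]: the projection onto degree at most n is [proj n.+1]. *)
Definition proj N f : 'rV[R]_d.+1 -> R := ycomb Y N (ycoef Y f).

Lemma proj_bdmeas N f : bdmeas (proj N f).
Proof. exact: ycomb_bdmeas. Qed.

Lemma projB_orthogonal n M f p : bdmeas f -> polyfun n p -> (n < M)%N ->
  L2dot (fun x => f x - proj M f x) p = 0.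
Proof.
move=> bf pp nM.
have bfM : bdmeas (fun x => f x - proj M f x).
  by apply: bdmeasB => //; exact: proj_bdmeas.
rewrite L2dotC (eq_L2dot (f' := ycomb Y n.+1 (ycoef Y p))
  (g' := fun x => f x - proj M f x))//; last first.
  by move=> x Sx; exact: polyfun_expansion.
rewrite L2dot_ycomb// /ysum big1// => l _; rewrite big1// => k _.
rewrite L2dotC L2dotBl//; [|exact: proj_bdmeas|exact: basis_bdmeas].
rewrite ycomb_coef//; last by apply: leq_trans nM; exact: ltn_ord.
by rewrite subrr mulr0.
Qed.

Lemma basis_sqr_sum_le l x : S x -> \sum_(k < dim_harmonic d l) Y k x ^+ 2 <=
  (2 * d ^ (d - 1))%:R / area * (1 + l%:R) ^+ (d - 1).
Proof.
move=> Sx; rewrite mulrAC ler_pdivlMr ?area_gt0//.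
rewrite addition_theorem// nat1r -natrX -natrM ler_nat.
exact: dim_harmonic_le.
Qed.

Lemma kern_le n x : S x ->
  kern Y n.+1 x <= (2 * d ^ (d - 1))%:R / area * n.+1%:R ^+ d.
Proof.
move=> Sx; have A0 : 0 <= (2 * d ^ (d - 1))%:R / area.
  by rewrite divr_ge0// ltW// area_gt0.
apply: (@le_trans _ _ (\sum_(l < n.+1)
    (2 * d ^ (d - 1))%:R / area * n.+1%:R ^+ (d - 1))).
  apply: ler_sum => l _; apply: le_trans (basis_sqr_sum_le l Sx) _.
  by rewrite ler_wpM2l// nat1r lerXn2r ?nnegrE// ler_nat.
rewrite sumr_const card_ord -[_ *+ _]mulr_natr -mulrA -exprSr.
by rewrite subn1 prednK.
Qed.

Variables (a : nat -> R) (s C0 : R).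
Hypothesis s_gt : d%:R / 2 < s.
Hypothesis a_gt0 : forall l, 0 < a l.
Hypothesis a_le : forall l, a l <= C0 * (1 + l%:R) `^ (- (2 * s)).

(** a_l is O(l^(-2 s)) and the sum of squares of the Y_(l,k) is O(l^(d - 1)), so their product is
    O(l^-(1 + eta)). *)
Let eta := 2 * s - d%:R.

Let eta_gt0 : 0 < eta.
Proof. by rewrite subr_gt0 mulrC -ltr_pdivrMr. Qed.

Let s_gt0 : 0 < s.
Proof. by apply: le_lt_trans s_gt; rewrite divr_ge0. Qed.

Let C0_gt0 : 0 < C0.
Proof.
have := lt_le_trans (a_gt0 0) (a_le 0).
by rewrite addr0 powR1 mulr1.
Qed.

(** Uniform bound for the tail of the reproducing kernel of H^s on the diagonal; at N = 0 it is the
    square of a constant of the embedding into continuous functions. *)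
Definition embedding_tail N : R :=
  C0 * ((2 * d ^ (d - 1))%:R / area) * zeta_tail eta N.

Lemma weighted_kern_tail N M x : S x -> (N <= M)%N ->
  ysum M (fun l k => if (l < N)%N then 0 else a l * Y k x ^+ 2)
  <= embedding_tail N.
Proof.
move=> Sx NM.
pose K := C0 * ((2 * d ^ (d - 1))%:R / area).
have K0 : 0 <= K by rewrite mulr_ge0 ?divr_ge0 ?(ltW C0_gt0)// ltW// area_gt0.
apply: (@le_trans _ _ (\sum_(l < M)
    if (l < N)%N then 0 else K * (1 + l%:R) `^ (- (1 + eta)))).
  apply: ler_sum => l _; case: ifP => _; first by rewrite big1.
  rewrite -mulr_sumr; apply: le_trans (_ : C0 * (1 + l%:R) `^ (- (2 * s)) *
    ((2 * d ^ (d - 1))%:R / area * (1 + l%:R) ^+ (d - 1)) <= _).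
    apply: ler_pM => //; first exact: ltW.
      by apply: sumr_ge0 => *; exact: sqr_ge0.
    exact: basis_sqr_sum_le.
  have l0 : 0 < 1 + l%:R :> R by rewrite ltr_pwDl.
  have -> : (1 + l%:R) `^ (- (1 + eta)) =
      (1 + l%:R) `^ (- (2 * s)) * (1 + l%:R) ^+ (d - 1).
    rewrite -powR_mulrn ?(ltW l0)// -powRD; last by rewrite (gt_eqF l0) implybT.
    by congr (_ `^ _); rewrite natrB// /eta; ring.
  by rewrite le_eqVlt; apply/orP; left; apply/eqP; rewrite /K; ring.
have -> : \sum_(l < M) (if (l < N)%N then 0 else K * (1 + l%:R) `^ (- (1 +
  eta)))
    = K * \sum_(N <= l < M) (1 + l%:R) `^ (- (1 + eta)).
  rewrite mulr_sumr -(big_mkord xpredT (fun l =>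
    if (l < N)%N then 0 else K * (1 + l%:R) `^ (- (1 + eta)))).
  rewrite (big_cat_nat (leq0n N) NM)/= big_nat big1 ?add0r; last first.
    by move=> l /andP[_ ->].
  rewrite big_nat [RHS]big_nat; apply: eq_bigr => l /andP[Nl _].
  by rewrite ltnNge Nl.
by rewrite /embedding_tail ler_wpM2l// zeta_tailP.
Qed.

Variables (f : 'rV[R]_d.+1 -> R) (H : R).
Hypothesis bf : bdmeas f.
Hypothesis H_ge0 : 0 <= H.
Hypothesis H_bound : forall N,
  ysum N (fun l k => (a l)^-1 * ycoef Y f k ^+ 2) <= H ^+ 2.

Lemma embedding_tail_ge0 N : 0 <= embedding_tail N.
Proof.
rewrite !mulr_ge0 ?zeta_tail_ge0 ?(ltW C0_gt0) ?divr_ge0//.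
by rewrite invr_ge0 ltW// area_gt0.
Qed.

(** Cauchy-Schwarz after multiplying and dividing each coefficient by sqrt(a_l). *)
Lemma proj_cauchy N M x : S x -> (N <= M)%N ->
  `|proj M f x - proj N f x| <= H * Num.sqrt (embedding_tail N).
Proof.
move=> Sx NM; rewrite /proj /ycomb (ysum_trunc _ NM) -ysumB.
have -> : ysum M (fun l k => ycoef Y f k * Y k x -
      (if (l < N)%N then ycoef Y f k * Y k x else 0)) =
    ysum M (fun l k => (Num.sqrt (a l)^-1 * ycoef Y f k) *
      (if (l < N)%N then 0 else Num.sqrt (a l) * Y k x)).
  apply: eq_ysum => l k _; case: ifP => _; first by rewrite subrr mulr0.
  rewrite subr0 mulrACA -sqrtrM ?invr_ge0 ?(ltW (a_gt0 l))//.
  by rewrite mulVf ?gt_eqF// sqrtr1 mul1r.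
rewrite -(@ler_pXn2r _ 2)// ?nnegrE ?mulr_ge0// real_normK ?num_real//.
apply: le_trans (ysum_CauchySchwarz _ _ _) _.
rewrite exprMn sqr_sqrtr ?embedding_tail_ge0//.
apply: ler_pM; try (by apply: ysum_ge0 => *; exact: sqr_ge0).
  apply: le_trans (H_bound M); apply: ler_ysum => l k _.
  by rewrite exprMn sqr_sqrtr// invr_ge0 ltW.
apply: le_trans (weighted_kern_tail Sx NM); apply: ler_ysum => l k _.
case: ifP => _; first by rewrite expr0n.
by rewrite exprMn sqr_sqrtr// ltW.
Qed.

Hypothesis cf : {within S, continuous f}.

(* If [f] differs from its [N]-th partial sum by more than the tail at [x0], so
   do, with the same sign near [x0], all further partial sums; but the
   difference is orthogonal to the peaks at [x0]. *)
Lemma sobolev_uniform_approximation N x : S x ->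
  `|f x - proj N f x| <= H * Num.sqrt (embedding_tail N).
Proof.
move=> Sx0; set dl := H * _; rewrite leNgt; apply/negP => gap.
set x0 := x in Sx0 gap; pose g y := f y - proj N f y.
(* The partial sum is controlled on the sphere only, so continuity is read off a polynomial
   representative. *)
have cg : exists2 q : 'rV[R]_d.+1 -> R, {within S, continuous q} &
    forall y, S y -> q y = g y.
  have [q _ qE] := ycomb_polyfun hY N (ycoef Y f).
  exists (fun y => f y - peval q y); last by move=> y Sy; rewrite /g /proj qE.
  have cq : {within S, continuous (peval q)}.
    by apply: continuous_subspaceT => ?; exact: continuous_peval.
  exact: within_continuousB.
have [q cq qg] := cg.
pose sg : R := if 0 <= g x0 then 1 else -1.
have sgn z : `|sg * z| = `|z|.
  by rewrite normrM /sg; case: ifP; rewrite ?normrN normr1 mul1r.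
have sgg : sg * g x0 = `|g x0|.
  rewrite /sg; case: ifPn => [g0|]; first by rewrite mul1r ger0_norm.
  by rewrite -ltNge => g0; rewrite mulN1r ltr0_norm.
(* Half the excess: near [x0], sg g >= |g x0| - ga, and passing from N to M costs at most dl, so r
   >= ga there. *)
pose ga := (`|g x0| - dl) / 2.
have ga0 : 0 < ga by rewrite divr_gt0// subr_gt0.
have [e [e0 e1 eC]] := within_continuous_cap cq Sx0 ga0.
have bg : bdmeas g by apply: bdmeasB => //; exact: proj_bdmeas.
have [_ [B gB]] := bg.
have [D HD] := peak_integral_gt0 (B + dl) Sx0 e0 e1 ga0.
(* Beyond the degree [D] of the peak, to which f - proj M f is then orthogonal. *)
pose M := maxn N D.+1.
have NM : (N <= M)%N by rewrite leq_maxl.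
pose r y := sg * (f y - proj M f y).
have bM : bdmeas (fun y => f y - proj M f y).
  by apply: bdmeasB => //; exact: proj_bdmeas.
have rE y : r y = sg * g y - sg * (proj M f y - proj N f y).
  by rewrite /r /g; ring.
have close y : S y -> `|sg * (proj M f y - proj N f y)| <= dl.
  by move=> Sy; rewrite sgn; exact: proj_cauchy.
have : 0 < L (fun y => r y * peak x0 D y).
  apply: HD.
  - exact: bdmeasZ.
  - move=> y Sy; rewrite rE; apply: le_trans (ler_normB _ _) (lerD _ (close y
      Sy)).
    by rewrite sgn; exact: gB.
  - move=> y Sy yC; rewrite rE.
    have := close y Sy; rewrite ler_norml => /andP[_ c1].
    have : `|sg * (g x0 - g y)| < ga by rewrite sgn -!qg//; exact: eC.
    rewrite mulrBr sgg ltr_norml => /andP[_ c2].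
    by move: c1 c2; rewrite /ga; lra.
have -> : L (fun y => r y * peak x0 D y) =
    sg * L2dot (fun y => f y - proj M f y) (peak x0 D).
  rewrite -sphere_integralZ; last by apply: bdmeasM => //; exact: bdmeas_peak.
  by apply: eq_sphere_integral => y _; rewrite /r mulrA.
by rewrite (projB_orthogonal bf (polyfun_peak x0 D)) ?mulr0 ?ltxx// leq_maxr.
Qed.

Lemma sobolev_sup_bound x : S x -> `|f x| <= H * Num.sqrt (embedding_tail 0).
Proof.
move=> Sx; have := sobolev_uniform_approximation 0 Sx.
by rewrite /proj /ycomb /ysum big_ord0 subr0.
Qed.

(** The defect in Bessel's inequality is cut at some large N >= n. Beyond N, uniform approximation
    makes it at most e, which is Parseval's identity in the limit; between n and N the coefficients
    are compared with the weights. *)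
Lemma sobolev_L2_approximation n :
  L2norm (fun x => f x - proj n f x) <=
    Num.sqrt C0 * (1 + n%:R) `^ (- s) * H.
Proof.
have n0 : 0 < 1 + n%:R :> R by rewrite ltr_pwDl.
rewrite -(@ler_pXn2r _ 2)// ?nnegrE ?L2norm_ge0 ?mulr_ge0 ?powR_ge0//.
rewrite sqr_L2norm !exprMn sqr_sqrtr ?(ltW C0_gt0)//.
rewrite -[_ `^ _ ^+ 2]powR_mulrn ?powR_ge0// -powRrM mulNr (mulrC s).
rewrite bessel//.
apply/ler_addgt0Pr => e e0.
have K0 : 0 <= C0 * ((2 * d ^ (d - 1))%:R / area).
  by rewrite mulr_ge0 ?divr_ge0 ?(ltW C0_gt0)// ltW// area_gt0.
(* Q times [zeta_tail eta N] is the square of the uniform error at N times the area. Q may vanish,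
   hence Q + 1 below. *)
pose Q := H ^+ 2 * (C0 * ((2 * d ^ (d - 1))%:R / area)) * area.
have Q0 : 0 <= Q by rewrite mulr_ge0 ?(ltW area_gt0)// mulr_ge0 ?sqr_ge0.
have [|N0 HN0] := @zeta_tail_small R eta (e / (Q + 1)) eta_gt0.
  by rewrite divr_gt0//; lra.
pose N := maxn n N0.
have nN : (n <= N)%N by rewrite leq_maxl.
have tl : Q * zeta_tail eta N <= e.
  apply: (@le_trans _ _ (Q * (e / (Q + 1)))).
    by rewrite ler_wpM2l// HN0// leq_maxr.
  by rewrite mulrCA ger_pMr// ler_pdivrMr; lra.
have h1 : L2dot f f - ysum N (fun l k => ycoef Y f k ^+ 2) <= e.
  rewrite -bessel//; apply: le_trans tl.
  have bN : bdmeas (fun x => f x - proj N f x).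
    by apply: bdmeasB => //; exact: proj_bdmeas.
  apply: le_trans (ler_norm _) _.
  apply: le_trans (le_norm_sphere_integral (M := H ^+ 2 * embedding_tail N)
    (bdmeasM bN bN) _) _.
    move=> x Sx; rewrite -expr2 normrX.
    rewrite -[embedding_tail N]sqr_sqrtr ?embedding_tail_ge0// -exprMn.
    rewrite lerXn2r ?nnegrE ?mulr_ge0//.
    exact: sobolev_uniform_approximation.
  by rewrite /Q /embedding_tail le_eqVlt; apply/orP; left; apply/eqP; ring.
have h2 : ysum N (fun l k => ycoef Y f k ^+ 2) -
    ysum n (fun l k => ycoef Y f k ^+ 2) <=
    C0 * (1 + n%:R) `^ (- (2 * s)) * H ^+ 2.
  rewrite (ysum_trunc _ nN) -ysumB.
  apply: (@le_trans _ _ (ysum N (fun l k => C0 * (1 + n%:R) `^ (- (2 * s)) *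
    ((a l)^-1 * ycoef Y f k ^+ 2)))).
    apply: ler_ysum => l k _; case: ifPn => [_|].
      rewrite subrr; apply: mulr_ge0.
        by rewrite mulr_ge0 ?powR_ge0 ?(ltW C0_gt0).
      by rewrite mulr_ge0 ?sqr_ge0// invr_ge0 ltW.
    move=> nl'; have nl : (n <= l)%N by rewrite leqNgt.
    rewrite subr0 mulrA ler_peMl ?sqr_ge0//.
    rewrite ler_pdivlMr// mul1r; apply: le_trans (a_le l) _.
    have l0 : 0 < 1 + l%:R :> R by rewrite ltr_pwDl.
    rewrite ler_wpM2l ?(ltW C0_gt0)// !powRN lef_pV2 ?posrE ?powR_gt0//.
    rewrite ge0_ler_powR ?nnegrE ?(ltW n0) ?addr_ge0// ?lerD2l ?ler_nat//.
    by rewrite mulr_ge0// ltW.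
  rewrite ysumZ ler_wpM2l// mulr_ge0 ?powR_ge0// ltW//.
by move: h1 h2; lra.
Qed.

End sobolev_approximation.

(** * Products with polynomials *)

Section block_sums.
Context {R : realType}.

Lemma sum_blocks (n Q : nat) (h : nat -> R) :
  \sum_(0 <= q < Q) \sum_(q * n <= l < q.+1 * n) h l = \sum_(0 <=
    l < Q * n) h l.
Proof.
elim: Q => [|Q IHQ]; first by rewrite mul0n !big_nil.
rewrite big_nat_recr//= IHQ -big_cat_nat//.
by rewrite leq_mul2r leqnSn orbT.
Qed.

Lemma sum_nat_sub (h : nat -> R) m n m' n' : (forall l, 0 <= h l) ->
  (m' <= m)%N -> (n <= n')%N ->
  \sum_(m <= l < n) h l <= \sum_(m' <= l < n') h l.
Proof.
move=> h0 m'm nn'; have [nm|mn] := leqP n m.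
  by rewrite big_geq// sumr_ge0.
rewrite (big_cat_nat m'm (leq_trans (ltnW mn) nn'))/=.
rewrite (big_cat_nat (ltnW mn) nn')/=.
by rewrite addrCA lerDl addr_ge0// sumr_ge0.
Qed.

(* Every index belongs to at most three of the enlarged blocks. *)
Lemma sum_enlarged_blocks (n Q : nat) (h : nat -> R) (B : R) :
  (forall l, 0 <= h l) -> (forall N, \sum_(0 <= l < N) h l <= B) ->
  \sum_(2 <= q < Q) \sum_((q - 1) * n <= l < (q + 2) * n) h l <= 3 * B.
Proof.
move=> h0 hB; pose b q := \sum_(q * n <= l < q.+1 * n) h l.
have b0 q : 0 <= b q by apply: sumr_ge0.
have bB m k : \sum_(m <= q < k) b q <= B.
  apply: le_trans (sum_nat_sub b0 (leq0n m) (leqnn k)) _.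
  by rewrite sum_blocks.
have -> : \sum_(2 <= q < Q) \sum_((q - 1) * n <= l < (q + 2) * n) h l =
    \sum_(2 <= q < Q) b (q - 1)%N + \sum_(2 <= q < Q) b q
    + \sum_(2 <= q < Q) b q.+1.
  rewrite -!big_split/= big_nat [RHS]big_nat; apply: eq_bigr => q /andP[q2 _].
  rewrite /b -subSn ?(leq_trans _ q2)// subSS subn0 addn2.
  rewrite -big_cat_nat ?leq_mul2r ?leq_subr ?leqnSn ?orbT//.
  rewrite -big_cat_nat ?leq_mul2r ?leqnSn ?orbT//.
  by rewrite (leq_trans (leq_subr _ _) (leqnSn _)) orbT.
have E1 : \sum_(2 <= q < Q) b (q - 1)%N = \sum_(1 <= q < Q - 1) b q.
  by rewrite -[2%N]/(1 + 1)%N big_addn; apply: eq_bigr => q _; rewrite addnK.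
have E2 : \sum_(2 <= q < Q) b q.+1 = \sum_(3 <= q < Q.+1) b q.
  by rewrite [RHS]big_add1.
rewrite E1 E2.
have := bB 1%N (Q - 1)%N; have := bB 2%N Q; have := bB 3%N Q.+1.
by move=> *; lra.
Qed.

End block_sums.

(** * The Sobolev norm of a product with a polynomial *)

Section sobolev_product.
Context {R : realType} {d : nat}.
Hypothesis d_ge2 : (2 <= d)%N.
Local Notation S := (sphere d : set 'rV[R]_d.+1).
Local Notation L := (@sphere_integral R d).
Local Notation idx l := 'I_(dim_harmonic d l).
Local Notation area := (L (fun=> 1)).

Let d_gt0 : (0 < d)%N. Proof. exact: ltnW. Qed.

Variable Y : forall l : nat, idx l -> 'rV[R]_d.+1 -> R.
Hypothesis hY : harmonic_basis Y.

Variables (a : nat -> R) (s c0 C0 : R).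
Hypothesis s_gt : d%:R / 2 < s.
Hypothesis a_gt0 : forall l, 0 < a l.
Hypothesis c0_gt0 : 0 < c0.
Hypothesis a_ge : forall l, c0 * (1 + l%:R) `^ (- (2 * s)) <= a l.
Hypothesis a_le : forall l, a l <= C0 * (1 + l%:R) `^ (- (2 * s)).

Let s_gt0 : 0 < s.
Proof. by apply: le_lt_trans s_gt; rewrite divr_ge0. Qed.

Let C0_gt0 : 0 < C0.
Proof.
have := lt_le_trans (a_gt0 0) (a_le 0).
by rewrite addr0 powR1 mulr1.
Qed.

Variables (f : 'rV[R]_d.+1 -> R) (H : R).
Hypothesis bf : bdmeas f.
Hypothesis H_ge0 : 0 <= H.
Hypothesis H_bound : forall N,
  ysum N (fun l k => (a l)^-1 * ycoef Y f k ^+ 2) <= H ^+ 2.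
Hypothesis cf : {within S, continuous f}.

Variables (n : nat) (p : 'rV[R]_d.+1 -> R).
Hypothesis n_gt0 : (0 < n)%N.
Hypothesis pp : polyfun n p.

Let F x := f x * p x.

Let bp : bdmeas p. Proof. exact: polyfun_bdmeas pp. Qed.

Let bF : bdmeas F. Proof. exact: bdmeasM. Qed.

Let energy g l : R := \sum_(k < dim_harmonic d l) ycoef Y g (k : idx l) ^+ 2.

Let energy_ge0 g l : 0 <= energy g l.
Proof. by apply: sumr_ge0 => k _; exact: sqr_ge0. Qed.

Let sum_energy_le m N g : bdmeas g -> \sum_(m <= l < N) energy g l <= L2dot g g.
Proof.
move=> bg; apply: le_trans (bessel_le d_gt0 hY N bg).
rewrite /ysum -(big_mkord xpredT (energy g)).
exact: sum_nat_sub.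
Qed.

(* [p * Y k] has degree at most [l + n], and [p * g] has no component of degree
   [l] when [g] has degree less than [l - n]. *)
Lemma product_coef_window A B l (k : idx l) : (A.-1 + n < l)%N ->
  (l + n < B)%N ->
  ycoef Y F k = ycoef Y (fun x => (proj Y B f x - proj Y A f x) * p x) k.
Proof.
move=> Al lB; have bA := proj_bdmeas hY A f; have bB := proj_bdmeas hY B f.
have bAp := bdmeasM bA bp.
have bBp := bdmeasM bB bp.
have bY := basis_bdmeas hY k.
have bpY := bdmeasM bp bY.
have eA : L2dot (fun x => proj Y A f x * p x) (Y k) = 0.
  apply: (polyfun_coef0 d_gt0 hY (n := A.-1 + n) (l := l)) => //.
  apply: polyfunM => //; exact: ycomb_polyfun.
have eB : L2dot (fun x => f x - proj Y B f x) (fun x => p x * Y k x) = 0.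
  apply: (projB_orthogonal d_ge2 hY (n := n + l)) => //; last by rewrite addnC.
  by apply: polyfunM => //; exact: basis_polyfun.
rewrite /ycoef; transitivity (L2dot (fun x => proj Y B f x * p x) (Y k)).
  apply/eqP; rewrite -subr_eq0 -L2dotBl//; apply/eqP; rewrite -eB.
  by apply: eq_sphere_integral => x _; rewrite /F; ring.
rewrite -[LHS]subr0 -eA -L2dotBl//.
by apply: eq_L2dot => // x _; rewrite mulrBl.
Qed.

Let p_sup2 := (2 * d ^ (d - 1))%:R / area * n.+1%:R ^+ d * L2dot p p.

Let p_le x : S x -> p x ^+ 2 <= p_sup2.
Proof.
move=> Sx; apply: le_trans (polyfun_pointwise d_gt0 hY pp Sx) _.
by apply: ler_wpM2r; [exact: L2dot_ge0|exact: kern_le].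
Qed.

Let p_sup2_ge0 : 0 <= p_sup2.
Proof. exact: le_trans (sqr_ge0 _) (p_le sphere_nonempty). Qed.

(** On the block, [product_coef_window] replaces f by its components of degree in [A, B); Bessel's
    inequality and the sup bound of p then apply to that product. *)
Lemma block_energy_le A B l0 l1 : (A <= B)%N -> (A.-1 + n < l0)%N ->
  (l1 + n <= B)%N ->
  \sum_(l0 <= l < l1) energy F l <= p_sup2 * \sum_(A <= j < B) energy f j.
Proof.
move=> AB Al lB; pose g x := proj Y B f x - proj Y A f x.
have bA := proj_bdmeas hY A f; have bB := proj_bdmeas hY B f.
have bg : bdmeas g by exact: bdmeasB.
pose gp x := g x * p x; have bgp : bdmeas gp by exact: bdmeasM.
have -> : \sum_(l0 <= l < l1) energy F l = \sum_(l0 <= l < l1) energy gp l.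
  rewrite big_nat [RHS]big_nat; apply: eq_bigr => l /andP[ll0 ll1].
  apply: eq_bigr => k _; congr (_ ^+ 2); apply: product_coef_window.
    exact: leq_trans ll0.
  by apply: leq_trans lB; rewrite ltn_add2r.
apply: le_trans (sum_energy_le _ _ bgp) _.
apply: (@le_trans _ _ (p_sup2 * L2dot g g)).
  rewrite /L2dot -sphere_integralZ; last exact: bdmeasM.
  apply: le_sphere_integral; [exact: bdmeasM|exact/bdmeasZ/bdmeasM|].
  move=> x Sx; rewrite /gp mulrACA -!expr2 mulrC ler_wpM2r ?sqr_ge0//.
  exact: p_le.
apply: ler_wpM2l => //.
have gE x : g x = ycomb Y B (fun l k => if (l < A)%N then 0 else ycoef Y f k) x.
  rewrite /g /proj /ycomb (ysum_trunc _ AB) -ysumB; apply: eq_ysum => l k _.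
  by case: ifP => _; rewrite ?subrr ?mul0r ?subr0.
rewrite (eq_L2dot (fun x _ => gE x) (fun x _ => gE x)) L2dot_ycombE//.
rewrite /ysum -(big_mkord xpredT (fun l => \sum_(k < dim_harmonic d l)
  (if (l < A)%N then 0 else ycoef Y f (k : idx l)) *
  (if (l < A)%N then 0 else ycoef Y f (k : idx l)))).
rewrite (big_cat_nat (leq0n A) AB)/= big_nat big1 ?add0r; last first.
  by move=> l /andP[_ lA]; rewrite big1// => k _; rewrite lA mul0r.
rewrite le_eqVlt; apply/orP; left; apply/eqP.
rewrite big_nat [RHS]big_nat; apply: eq_bigr => l /andP[Al' _].
by apply: eq_bigr => k _; rewrite ltnNge Al'.
Qed.

Let w l : R := (1 + l%:R) `^ (2 * s).

Let w_gt0 l : 0 < w l. Proof. by rewrite powR_gt0// ltr_pwDl. Qed.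

Let w_le l m : (l.+1 <= m)%N -> w l <= m%:R `^ (2 * s).
Proof.
move=> lm; rewrite /w nat1r ge0_ler_powR ?nnegrE ?ler_nat//.
by rewrite mulr_ge0// ltW.
Qed.

Let h l := (a l)^-1 * energy f l.

Let h_ge0 l : 0 <= h l.
Proof. by rewrite mulr_ge0// invr_ge0 ltW. Qed.

Let sum_h N : \sum_(0 <= l < N) h l <= H ^+ 2.
Proof.
apply: le_trans (H_bound N); rewrite /ysum big_mkord.
by apply: ler_sum => l _; rewrite /h mulr_sumr.
Qed.

Let w_energy_le l : w l * energy f l <= C0 * h l.
Proof.
rewrite /h mulrA ler_wpM2r// ler_pdivlMr//.
rewrite -ler_pdivlMl// mulrC; apply: le_trans (a_le l) _.
by rewrite powRN.
Qed.

(** For q >= 2, q + 1 <= 3 (q - 1): the weight on a block is at most 3^(2 s) times the weight on the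
    matching window of f. The last factor 3 is the overlap of the windows. *)
Lemma high_energy_le Q :
  \sum_(2 <= q < Q) \sum_(q * n <= l < q.+1 * n) w l * energy F l <=
  3 `^ (2 * s) * p_sup2 * C0 * (3 * H ^+ 2).
Proof.
pose K := 3 `^ (2 * s) * p_sup2 * C0.
have K0 : 0 <= K.
  by apply: mulr_ge0 (ltW C0_gt0); apply: mulr_ge0 p_sup2_ge0; exact: powR_ge0.
apply: (@le_trans _ _ (\sum_(2 <= q < Q) K *
    \sum_((q - 1) * n <= l < (q + 2) * n) h l)); last first.
  by rewrite -mulr_sumr ler_wpM2l// sum_enlarged_blocks.
rewrite big_nat [leRHS]big_nat; apply: ler_sum => q /andP[q2 _].
have q1 : (0 < q - 1)%N by rewrite subn_gt0.
have A0 : (0 < (q - 1) * n)%N by rewrite muln_gt0 q1.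
pose W := (q.+1 * n)%:R `^ (2 * s) : R.
apply: (@le_trans _ _ (W * \sum_(q * n <= l < q.+1 * n) energy F l)).
  rewrite mulr_sumr big_nat [leRHS]big_nat; apply: ler_sum => l /andP[_ lq].
  by rewrite ler_wpM2r// w_le.
apply: (@le_trans _ _ (W * (p_sup2 *
    \sum_((q - 1) * n <= j < (q + 2) * n) energy f j))).
  apply: ler_wpM2l; first exact: powR_ge0.
  apply: block_energy_le.
  - by rewrite leq_mul2r (leq_trans (leq_subr _ _) (leq_addr _ _)) orbT.
  - rewrite -ltnS -addSn prednK// -mulSnr -subSn ?(leq_trans _ q2)//.
    by rewrite subSS subn0.
  - by rewrite addn2 (mulSn q.+1) addnC.
rewrite !mulr_sumr big_nat [leRHS]big_nat; apply: ler_sum => j /andP[qj _].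
apply: (@le_trans _ _ (3 `^ (2 * s) * p_sup2 * (w j * energy f j))); last first.
  by rewrite /K -[leRHS]mulrA ler_wpM2l// mulr_ge0// powR_ge0.
rewrite [leLHS]mulrCA -[_ * p_sup2 * _]mulrA [leRHS]mulrCA ler_wpM2l//.
rewrite mulrA ler_wpM2r// /W /w -powRM ?addr_ge0//.
rewrite ge0_ler_powR ?nnegrE ?mulr_ge0 ?(ltW s_gt0) ?addr_ge0//.
rewrite nat1r -natrM ler_nat.
apply: (@leq_trans (3 * ((q - 1) * n))); last by rewrite leq_mul2l/= leqW.
rewrite mulnA leq_mul2r; apply/orP; right.
by move: q2; lia.
Qed.

Lemma low_energy_le :
  \sum_(0 <= l < 2 * n) w l * energy F l <=
  (2 * n)%:R `^ (2 * s) *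
  (H ^+ 2 * embedding_tail (R := R) (d := d) s C0 0 * L2dot p p).
Proof.
apply: (@le_trans _ _ ((2 * n)%:R `^ (2 * s) *
    \sum_(0 <= l < 2 * n) energy F l)).
  rewrite mulr_sumr big_nat [leRHS]big_nat; apply: ler_sum => l /andP[_ ln].
  by rewrite ler_wpM2r// w_le.
apply: ler_wpM2l; first exact: powR_ge0.
apply: le_trans (sum_energy_le _ _ bF) _.
rewrite /L2dot -sphere_integralZ; last exact: bdmeasM.
apply: le_sphere_integral; [exact: bdmeasM|exact/bdmeasZ/bdmeasM|].
move=> x Sx; rewrite /F mulrACA -!expr2 ler_wpM2r ?sqr_ge0//.
rewrite -[f x ^+ 2]real_normK ?num_real//.
rewrite -[embedding_tail _ _ _]sqr_sqrtr; last first.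
  exact: (embedding_tail_ge0 s_gt a_gt0 a_le).
rewrite -exprMn lerXn2r ?nnegrE ?mulr_ge0//.
exact: (sobolev_sup_bound d_ge2 hY s_gt a_gt0 a_le bf H_ge0 H_bound cf).
Qed.

(** [c0^-1] compares 1 / a_l with the model weight; the first summand comes from degrees below 2 n,
    as 2 n <= 2 (n + 1), the second from [high_energy_le]. *)
Definition product_const : R := c0^-1 *
  (2 `^ (2 * s) * embedding_tail (R := R) (d := d) s C0 0 +
   3 `^ (2 * s) * ((2 * d ^ (d - 1))%:R / area) * C0 * 3).

Lemma sobolev_product_bound N :
  ysum N (fun l k => (a l)^-1 * ycoef Y F k ^+ 2) <=
  (Num.sqrt product_const * n.+1%:R `^ s * H * L2norm p) ^+ 2.
Proof.
have et0 := embedding_tail_ge0 s_gt a_gt0 a_le 0.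
have A0 : 0 <= (2 * d ^ (d - 1))%:R / area by rewrite divr_ge0// ltW// area_gt0.
have PC0 : 0 <= product_const.
  apply: mulr_ge0; first by rewrite invr_ge0 ltW.
  apply: addr_ge0; first by apply: mulr_ge0 et0; exact: powR_ge0.
  apply: mulr_ge0 => //; apply: mulr_ge0 (ltW C0_gt0); apply: mulr_ge0 A0.
  exact: powR_ge0.
have N0 : 0 <= n.+1%:R :> R by [].
apply: (@le_trans _ _ (c0^-1 * \sum_(0 <= l < N) w l * energy F l)).
  rewrite /ysum -(big_mkord xpredT (fun l =>
    \sum_(k < dim_harmonic d l) (a l)^-1 * ycoef Y F (k : idx l) ^+ 2)).
  rewrite mulr_sumr; apply: ler_sum => l _; rewrite -mulr_sumr mulrA.
  have -> : w l = ((1 + l%:R) `^ (- (2 * s)))^-1 by rewrite powRN invrK.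
  apply: ler_wpM2r; first exact: (energy_ge0 F l).
  rewrite -invfM.
  by rewrite lef_pV2 ?posrE ?mulr_gt0 ?powR_gt0// ltr_pwDl.
have wE0 l : 0 <= w l * energy F l by rewrite mulr_ge0// ltW.
(* Completes the range to whole blocks of length n > 0, at least the two low ones. *)
apply: (@le_trans _ _ (c0^-1 * \sum_(0 <= l < N.+2 * n) w l * energy F l)).
  rewrite ler_wpM2l ?invr_ge0 ?(ltW c0_gt0)//.
  apply: sum_nat_sub => //; apply: (@leq_trans N.+2); first by rewrite ltnW.
  by rewrite leq_pmulr.
have -> : \sum_(0 <= l < N.+2 * n) w l * energy F l =
    \sum_(0 <= l < 2 * n) w l * energy F l +
    \sum_(2 <= q < N.+2) \sum_(q * n <= l < q.+1 * n) w l * energy F l.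
  rewrite -(sum_blocks n N.+2) (big_cat_nat (n := 2%N))//=.
  by rewrite sum_blocks.
have ci0 : 0 <= c0^-1 by rewrite invr_ge0 ltW.
apply: le_trans (ler_wpM2l ci0 (lerD low_energy_le (high_energy_le N.+2))) _.
have nE : (n.+1%:R `^ s) ^+ 2 = n.+1%:R `^ (2 * s) :> R.
  by rewrite -powR_mulrn ?powR_ge0// -powRrM mulrC.
have n2 : (2 * n)%:R `^ (2 * s) <= 2 `^ (2 * s) * n.+1%:R `^ (2 * s) :> R.
  rewrite -powRM// -natrM ge0_ler_powR ?nnegrE ?mulr_ge0 ?(ltW s_gt0)//.
  by rewrite ler_nat leq_mul2l ltnW.
(* The price of the sup norm of p is absorbed here, since d < 2 s. *)
have nd : n.+1%:R ^+ d <= n.+1%:R `^ (2 * s) :> R.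
  rewrite -powR_mulrn// ler_powR ?ler1n//.
  by rewrite mulrC -ler_pdivrMr// ltW.
rewrite !exprMn sqr_sqrtr// sqr_L2norm nE /product_const /p_sup2.
set E0 := embedding_tail _ _ _ in et0 *; set A := _ / area in A0 *.
set P := L2dot p p; set z := n.+1%:R `^ _ in n2 nd *.
have HP0 : 0 <= H ^+ 2 * P by rewrite mulr_ge0 ?sqr_ge0 ?L2dot_ge0.
rewrite (_ : c0^-1 * _ * z * _ * P = c0^-1 * (2 `^ (2 * s) * z * (E0 * (H ^+ 2
  * P))
  + z * (3 `^ (2 * s) * A * C0 * 3 * (H ^+ 2 * P)))); last by ring.
apply: ler_wpM2l => //; apply: lerD.
  rewrite (_ : H ^+ 2 * E0 * P = E0 * (H ^+ 2 * P)); last by ring.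
  by apply: ler_wpM2r => //; exact: mulr_ge0.
rewrite (_ : 3 `^ (2 * s) * _ * C0 * _ = n.+1%:R ^+ d *
  (3 `^ (2 * s) * A * C0 * 3 * (H ^+ 2 * P))); last by ring.
apply: ler_wpM2r => //; apply: mulr_ge0 => //; apply: mulr_ge0 => //.
by apply: mulr_ge0 (ltW C0_gt0); apply: mulr_ge0 A0; exact: powR_ge0.
Qed.

End sobolev_product.

(** * Quadrature and hyperinterpolation *)

Section sobolev_norms.
Context {R : realType} {d : nat}.
Local Notation S := (sphere d : set 'rV[R]_d.+1).
Local Notation idx l := 'I_(dim_harmonic d l).
Variable a : nat -> R.
Hypothesis a_gt0 : forall l, 0 < a l.
Variable Y : forall l : nat, idx l -> 'rV[R]_d.+1 -> R.

Let term f l : R := \sum_(k < dim_harmonic d l)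
  (a l)^-1 * `|L2dot f (Y (k : idx l))| ^+ 2.

Let term_ge0 f l : 0 <= term f l.
Proof.
by apply: sumr_ge0 => k _; rewrite mulr_ge0 ?exprn_ge0// invr_ge0 ltW.
Qed.

Let sum_term f N : \sum_(0 <= l < N) term f l =
  ysum N (fun l k => (a l)^-1 * ycoef Y f k ^+ 2).
Proof.
rewrite big_mkord; apply: eq_bigr => l _; apply: eq_bigr => k _.
by rewrite real_normK ?num_real.
Qed.

Lemma sobolev_bdmeas f : sobolev a Y f -> bdmeas f.
Proof.
by move=> [cf [mf _] _]; split => //; exact: within_continuous_bounded.
Qed.

Lemma sobolev_norm_ge0 f : 0 <= sobolev_norm a Y f.
Proof. exact: sqrtr_ge0. Qed.

Lemma sobolev_norm_bound f N : sobolev a Y f ->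
  ysum N (fun l k => (a l)^-1 * ycoef Y f k ^+ 2) <= sobolev_norm a Y f ^+ 2.
Proof.
move=> [_ _ fin]; rewrite -sum_term.
have t0 l : (0 <= l)%N -> true -> (0 <= (term f l)%:E)%E.
  by move=> _ _; rewrite lee_fin.
have s0 : (0 <= sobolev_sqnorm a Y f)%E by apply: nneseries_ge0.
have fs : sobolev_sqnorm a Y f \is a fin_num by rewrite ge0_fin_numE.
rewrite /sobolev_norm sqr_sqrtr ?fine_ge0// -lee_fin fineK// -sumEFin.
exact: (nneseries_lim_ge N t0).
Qed.

(** Admits f p to the quadrature hypothesis. *)
Lemma sobolev_of_bound f B : 0 <= B -> {within S, continuous f} ->
  bdmeas f ->
  (forall N, ysum N (fun l k => (a l)^-1 * ycoef Y f k ^+ 2) <= B ^+ 2) ->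
  sobolev a Y f /\ sobolev_norm a Y f <= B.
Proof.
move=> B0 cf bf fB.
have t0 l : (0 <= l)%N -> true -> (0 <= (term f l)%:E)%E.
  by move=> _ _; rewrite lee_fin.
have s0 : (0 <= sobolev_sqnorm a Y f)%E by apply: nneseries_ge0.
have sB : (sobolev_sqnorm a Y f <= (B ^+ 2)%:E)%E.
  apply: lime_le; first exact: is_cvg_nneseries.
  by apply: nearW => N; rewrite sumEFin lee_fin sum_term.
have slt : (sobolev_sqnorm a Y f < +oo)%E by apply: le_lt_trans sB _;
  rewrite ltry.
split.
  split => //; split; first by case: bf.
  by apply: bdmeas_integrable; exact: bdmeasX.
rewrite -(@ler_pXn2r _ 2)// ?nnegrE ?sqrtr_ge0//.
rewrite sqr_sqrtr ?fine_ge0//.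
by rewrite -lee_fin fineK// ge0_fin_numE.
Qed.

(** Taking for [b] the discrete coefficients of f, the right-hand side becomes the squared norm of
    the hyperinterpolant. *)
Lemma discrete_dot_ycomb m (x : 'I_m -> 'rV[R]_d.+1) f N b :
  discrete_dot x f (ycomb Y N b) =
  ysum N (fun l k => b l k * discrete_dot x f (Y k)).
Proof.
rewrite /discrete_dot.
under [RHS]eq_bigr => l _ do under eq_bigr => k _ do rewrite mulrCA.
set A := _ / _; transitivity (A * ysum N (fun l k =>
    b l k * \sum_(j < m) f (x j) * Y k (x j))); last by rewrite -ysumZ.
congr (_ * _); under eq_bigr => j _ do rewrite mulr_sumr.
rewrite exchange_big /=; apply: eq_bigr => l _.
under eq_bigr => j _ do rewrite mulr_sumr.
rewrite exchange_big /=; apply: eq_bigr => k _.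
by rewrite mulr_sumr; apply: eq_bigr => j _; rewrite mulrCA.
Qed.

End sobolev_norms.

Section qmc_hyperinterpolation.
Context {R : realType} {d : nat}.
Hypothesis d_ge2 : (2 <= d)%N.
Local Notation S := (sphere d : set 'rV[R]_d.+1).
Local Notation idx l := 'I_(dim_harmonic d l).

Let d_gt0 : (0 < d)%N. Proof. exact: ltnW. Qed.

Variables (a : nat -> R) (s c0 C0 c : R).
Hypothesis s_gt : d%:R / 2 < s.
Hypothesis a_gt0 : forall l, 0 < a l.
Hypothesis c0_gt0 : 0 < c0.
Hypothesis a_ge : forall l, c0 * (1 + l%:R) `^ (- (2 * s)) <= a l.
Hypothesis a_le : forall l, a l <= C0 * (1 + l%:R) `^ (- (2 * s)).
Hypothesis c_gt0 : 0 < c.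

Variable Y : forall l : nat, idx l -> 'rV[R]_d.+1 -> R.
Hypothesis hY : harmonic_basis Y.
Variables (I : set nat) (X : forall m : nat, 'I_m -> 'rV[R]_d.+1).
Hypothesis hX : QMC_designs a Y s c I X.
Variables (f : 'rV[R]_d.+1 -> R) (n m : nat).
Hypothesis sf : sobolev a Y f.
Hypothesis n_gt0 : (0 < n)%N.
Hypothesis Im : I m.

Let H := sobolev_norm a Y f.
Let K := Num.sqrt (@product_const R d s c0 C0).
(** Quadrature error for f p per unit of the L^2 norm of p. *)
Let err : R := c / m%:R `^ (s / d%:R) * (K * n.+1%:R `^ s * H).

Let err_ge0 : 0 <= err.
Proof.
rewrite mulr_ge0 ?divr_ge0 ?powR_ge0 ?(ltW c_gt0)//.
by rewrite mulr_ge0 ?sqrtr_ge0// mulr_ge0 ?sqrtr_ge0 ?powR_ge0.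
Qed.

Let bf : bdmeas f. Proof. exact: sobolev_bdmeas sf. Qed.

Let cf : {within S, continuous f}. Proof. by case: sf. Qed.

Lemma qmc_product_error p : polyfun n p ->
  `|discrete_dot (@X m) f p - L2dot f p| <= err * L2norm p.
Proof.
move=> pp; have [_ /(_ _ Im)[_ XS] qmc] := hX; have [q qn pq] := pp.
(* The values of p off the sphere are arbitrary; its polynomial representative is continuous
   everywhere. *)
have qq : polyfun n (peval q) by exists q.
have cq : {within S, continuous (peval q)}.
  by apply: continuous_subspaceT => ?; exact: continuous_peval.
have np : L2norm (peval q) = L2norm p.
  by congr Num.sqrt; apply: eq_L2dot => x Sx; rewrite pq.
have [||||sF nF] := @sobolev_of_bound _ _ _ a_gt0 Y (fun x => f x * peval q x)
    (K * n.+1%:R `^ s * H * L2norm p).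
- by rewrite !mulr_ge0 ?sqrtr_ge0 ?powR_ge0.
- exact: within_continuousM.
- exact: bdmeasM bf (bdmeas_peval q).
- rewrite -np => N; apply: sobolev_product_bound => //.
  + exact: sobolev_norm_ge0.
  + by move=> N'; exact: sobolev_norm_bound.
rewrite /err -mulrA.
apply: le_trans (ler_wpM2l _ nF); last first.
  by rewrite divr_ge0 ?powR_ge0// ltW.
apply: le_trans (qmc m _ Im sF); rewrite le_eqVlt; apply/orP; left; apply/eqP.
congr `|_ * _ - _|; first by apply: eq_bigr => j _; rewrite pq//; exact: XS.
by apply: eq_sphere_integral => x Sx; rewrite pq.
Qed.

Let le_of_sqr_le (P A : R) : 0 <= P -> 0 <= A -> P ^+ 2 <= A * P -> P <= A.
Proof.
by rewrite le_eqVlt => /predU1P[<-//|P0] A0; rewrite expr2 ler_pM2r.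
Qed.

Lemma hyperinterpolant_norm_le :
  L2norm (hyperinterpolant Y n (@X m) f) <= L2norm f + err.
Proof.
set al := fun l (k : idx l) => discrete_dot (@X m) f (Y k).
have pE : hyperinterpolant Y n (@X m) f = ycomb Y n.+1 al by [].
rewrite pE; set p := ycomb Y n.+1 al.
have pp : polyfun n p by exact: (ycomb_polyfun hY n.+1).
have bp := polyfun_bdmeas pp.
apply: le_of_sqr_le; rewrite ?addr_ge0 ?L2norm_ge0//.
have E : discrete_dot (@X m) f p = L2norm p ^+ 2.
  by rewrite sqr_L2norm L2dot_ycombE// discrete_dot_ycomb.
have := qmc_product_error pp; rewrite E ler_norml => /andP[_].
have := L2dot_le_norm bf bp; rewrite ler_norml => /andP[_].
by rewrite mulrDl; lra.
Qed.

(** The coefficients of D = Q_n f - P_n f are the quadrature errors for f Y_(l,k), so <f, D>_m - <f,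
    D> is the squared norm of D. The rest r = f - P_n f is orthogonal to D, and Q_n f - f = D -
    r. *)
Lemma hyperinterpolant_error_le :
  L2norm (fun x => hyperinterpolant Y n (@X m) f x - f x) <=
  Num.sqrt C0 * (1 + n.+1%:R) `^ (- s) * H + err.
Proof.
pose de l (k : idx l) := discrete_dot (@X m) f (Y k) - ycoef Y f k.
pose D := ycomb Y n.+1 de.
have pD : polyfun n D by exact: (ycomb_polyfun hY n.+1).
have bD := polyfun_bdmeas pD.
have nD : L2norm D <= err.
  apply: le_of_sqr_le; rewrite ?L2norm_ge0//.
  apply: le_trans (qmc_product_error pD); apply: le_trans (ler_norm _).
  rewrite sqr_L2norm L2dot_ycombE// discrete_dot_ycomb (L2dotC f) L2dot_ycomb//.
  rewrite -ysumB le_eqVlt; apply/orP; left; apply/eqP.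
  by apply: eq_ysum => l k _; rewrite /de /ycoef (L2dotC _ f) -mulrBr.
pose r x := f x - proj Y n.+1 f x.
have br : bdmeas r by apply: bdmeasB => //; exact: proj_bdmeas.
have nr : L2norm r <= Num.sqrt C0 * (1 + n.+1%:R) `^ (- s) * H.
  apply: (sobolev_L2_approximation d_ge2 hY s_gt a_gt0 a_le) => //.
    exact: sobolev_norm_ge0.
  by move=> N; exact: sobolev_norm_bound.
have rD : L2dot D r = 0.
  by rewrite L2dotC; apply: (projB_orthogonal d_ge2 hY bf pD).
rewrite addrC; apply: le_trans (lerD nD nr).
rewrite -(@ler_pXn2r _ 2)// ?nnegrE ?addr_ge0 ?L2norm_ge0//.
rewrite sqr_L2norm (eq_L2dot (f' := fun x => D x - r x) (g' :=
  fun x => D x - r x)).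
- rewrite L2dot_sqB// rD sqrrD !sqr_L2norm mulr0 subr0 addrAC.
  by rewrite lerDl mulrn_wge0// mulr_ge0// L2norm_ge0.
all: move=> x _; have -> : hyperinterpolant Y n (@X m) f x =
    ysum n.+1 (fun l k => discrete_dot (@X m) f (Y k) * Y k x) by [].
all: rewrite /D /r /proj /ycomb opprB addrA -ysumD; congr (_ - _).
all: by apply: eq_ysum => l k _; rewrite /de -mulrDl subrK.
Qed.

End qmc_hyperinterpolation.

Unset Implicit Arguments.

Theorem theorem4p1 (R : realType) (d : nat) (s : R) (a : nat -> R) (c : R) :
  (2 <= d)%N -> d%:R / 2 < s -> sobolev_weights s a -> 0 < c ->
  exists c' c'' : R,
    [/\ 0 < c', 0 < c'' &
      forall (Y : forall l : nat, 'I_(dim_harmonic d l) -> 'rV[R]_d.+1 -> R)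
        (I : set nat) (X : forall m : nat, 'I_m -> 'rV[R]_d.+1),
      harmonic_basis Y -> QMC_designs a Y s c I X ->
      forall (f : 'rV[R]_d.+1 -> R) (n m : nat),
      sobolev a Y f -> (1 <= n)%N -> I m ->
      L2norm (hyperinterpolant Y n (X m) f)
        <= L2norm f
           + c' / m%:R `^ (s / d%:R) * n.+1%:R `^ s * sobolev_norm a Y f
      /\
      L2norm (fun x => hyperinterpolant Y n (X m) f x - f x)
        <= c'' * (n%:R `^ (- s)
                  + (m%:R `^ (s / d%:R))^-1
                    * Num.sqrt ((dim_harmonic d.+1 n)%:R / a n))
           * sobolev_norm a Y f].
Proof.
move=> d2 sd [a0 [c0 [C0 [c00 C00 ab]]]] cgt0.
have a_ge l : c0 * (1 + l%:R) `^ (- (2 * s)) <= a l by case/andP: (ab l).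
have a_le l : a l <= C0 * (1 + l%:R) `^ (- (2 * s)) by case/andP: (ab l).
set K := Num.sqrt (@product_const R d s c0 C0).
have K0 : 0 <= K by exact: sqrtr_ge0.
(* [K] is only known to be nonnegative; the + 1 keeps [c'] positive. *)
exists (c * (K + 1)), (Num.sqrt C0 * (1 + c * K)); split.
- by rewrite mulr_gt0// ltr_wpDl.
- by rewrite mulr_gt0 ?sqrtr_gt0// ltr_pwDl// mulr_ge0// ltW.
move=> Y I X hY hX f n m sf n1 Im.
set H := sobolev_norm a Y f.
have H0 : 0 <= H by exact: sobolev_norm_ge0.
have M0 : 0 <= (m%:R `^ (s / d%:R))^-1 :> R by rewrite invr_ge0 powR_ge0.
set M := (m%:R `^ (s / d%:R))^-1 in M0 *.
have s0 : 0 < s by apply: le_lt_trans sd; rewrite divr_ge0.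
split.
  apply: le_trans (hyperinterpolant_norm_le d2 sd a0 c00 a_ge a_le cgt0 hY hX
    sf n1 Im) _.
  rewrite lerD2l -/K -/H -/M -!mulrA ler_wpM2l ?(ltW cgt0)//.
  rewrite [leRHS]mulrCA ler_wpM2l// mulrDl mul1r lerDl.
  by rewrite mulr_ge0 ?powR_ge0.
apply: le_trans (hyperinterpolant_error_le d2 sd a0 c00 a_ge a_le cgt0 hY hX
  sf n1 Im) _; rewrite -/K -/H -/M.
set B := Num.sqrt (_ / a n).
(* (n + 1)^(2 s) <= C0 / a_n <= C0 Z(d + 1, n) / a_n, the dimension being at least 1. *)
have nB : n.+1%:R `^ s <= Num.sqrt C0 * B.
  rewrite -sqrtrM ?(ltW C00)// -[leLHS]ger0_norm ?powR_ge0// -sqrtr_sqr.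
  rewrite ler_wsqrtr//.
  have -> : (n.+1%:R `^ s) ^+ 2 = (n.+1%:R `^ (- (2 * s)))^-1 :> R.
    by rewrite -powRN opprK -powR_mulrn ?powR_ge0// -powRrM mulrC.
  rewrite mulrA ler_pdivlMr// ler_pdivrMl ?powR_gt0//.
  apply: le_trans (a_le n) _; rewrite nat1r [leLHS]mulrC.
  rewrite ler_wpM2l ?powR_ge0// ler_peMr ?(ltW C00)// ler1n.
  by apply: dim_harmonic_gt0; exact: ltnW.
have nA : (1 + n.+1%:R) `^ (- s) <= n%:R `^ (- s) :> R.
  rewrite !powRN lef_pV2 ?posrE ?powR_gt0 ?ltr0n// ?addr_gt0//.
  rewrite ge0_ler_powR ?nnegrE ?(ltW s0) ?addr_ge0// nat1r ler_nat.
  exact: leqW.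
set A := n%:R `^ (- s) in nA *.
have A0 : 0 <= A by exact: powR_ge0.
have B0 : 0 <= B by exact: sqrtr_ge0.
have C0' : 0 <= Num.sqrt C0 by exact: sqrtr_ge0.
apply: (@le_trans _ _ (Num.sqrt C0 * A * H + c * M * (K * (Num.sqrt C0 * B) *
  H))).
  apply: lerD; first by rewrite ler_wpM2r// ler_wpM2l.
  by rewrite ler_wpM2l ?mulr_ge0 ?(ltW cgt0)// ler_wpM2r// ler_wpM2l.
(* Expanding [c''] times the sum yields the two wanted terms and nonnegative cross terms. *)
rewrite (_ : Num.sqrt C0 * (1 + _) * _ * H = Num.sqrt C0 * A * H +
  c * M * (K * (Num.sqrt C0 * B) * H) +
  Num.sqrt C0 * H * (M * B + c * K * A)); last by ring.
rewrite lerDl; apply: mulr_ge0; first exact: mulr_ge0.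
by rewrite addr_ge0// ?mulr_ge0// ltW.
Qed.
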